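(* For every positive integer $\ell$ there exists an integer $g_\ell$ such that for all $g \geq g_\ell$ one has \[ [(g-\ell)^2+1, g^2] \cap R_g = R_{g,\ell} \sqcup R_{g,\ell-1} \sqcup \cdots \sqcup R_{g,2} \sqcup R_{g,1} \sqcup R_{g,0}, \] where $\sqcup$ denotes disjoint union (i.e. the sets $R_{g,0}, \dots, R_{g,\ell}$ are pairwise disjoint and their union is the left-hand side).
   Context: Abelian varieties are over the field $\mathbb{C}$ of complex numbers. The Picard number $\rho(A)$ of an abelian variety $A$ is the rank of its Néron–Severi group $\operatorname{NS}(A)$. For $g \geq 1$, $R_g$ denotes the set of all integers $\rho$ such that there exists an abelian variety $A$ of dimension $g$ with $\rho(A) = \rho$; by convention $R_0 = \{0\}$. For integers $0 \leq n \leq g$ set \[ R_{g,n} := \{ (g-n)^2 + x \mid x \in R_n \}. \] Thus $R_{g,0} = \{g^2\}$ and $R_{g,1} = \{(g-1)^2+1\}$. *)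

(* Defs.v *)
(* [R : realType] is the field of real numbers and [R[i]] the field of complex numbers.

   Complex abelian varieties are treated as in Birkenhake-Lange, "Complex
   Abelian Varieties": complex tori V/L with V = C^g that carry a positive
   definite holomorphic line bundle.  A holomorphic line bundle on V/L is given
   by a factor of automorphy (its pull-back to V is trivial), and the
   Neron-Severi group is the image of the first Chern class
   c_1 : Pic(V/L) -> H^2(V/L, Z), where H^2(V/L, Z) is the group of
   alternating integral bilinear forms on L. *)
From mathcomp Require Import all_boot all_order all_algebra.
From mathcomp Require Import all_classical all_reals all_analysis.
From mathcomp Require Import complex.

Set Implicit Arguments.
Unset Strict Implicit.
Unset Printing Implicit Defensive.

Import Order.TTheory GRing.Theory Num.Theory numFieldNormedType.Exports.

Local Open Scope classical_set_scope.
Local Open Scope ring_scope.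
Local Open Scope complex_scope.

(* [S] is meant to be (the underlying set of) a subgroup of [V], and [r] its
   rank: the largest number of elements of [S] that are linearly independent
   over the integers. *)
Definition Z_independent (V : zmodType) (n : nat) (v : 'I_n -> V) : Prop :=
  forall c : 'I_n -> int, \sum_(k < n) v k *~ c k = 0 -> forall k, c k = 0.

Definition has_rank (V : zmodType) (S : set V) (r : nat) : Prop :=
  (exists v : 'I_r -> V, (forall k, S (v k)) /\ Z_independent v) /\
  (forall (n : nat) (v : 'I_n -> V),
     (forall k, S (v k)) -> Z_independent v -> (n <= r)%N).

Definition cexp (R : realType) (z : R[i]) : R[i] :=
  let: x +i* y := z in (expR x * cos y) +i* (expR x * sin y).

(* [differentiable] over the field [R[i]] is complex differentiability. *)
Definition holomorphic (R : realType) (g : nat)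
    (f : 'rV[R[i]]_g -> R[i]^o) : Prop :=
  forall v, differentiable f v.

(* The torus C^g / L; the rows of [periods] are a basis of the lattice L, and
   L is identified with Z^(2g) through this basis. *)
Record complexTorus (R : realType) (g : nat) := ComplexTorus {
  periods : 'M[R[i]]_(g.*2, g);
  periods_free : forall s : 'rV[R]_(g.*2),
    map_mx (fun x => x%:C) s *m periods = 0 -> s = 0
}.

Section LineBundles.
Variables (R : realType) (g : nat) (A : complexTorus R g).

Definition real_point (s : 'rV[R]_(g.*2)) : 'rV[R[i]]_g :=
  map_mx (fun x => x%:C) s *m periods A.

Definition lattice_point (m : 'rV[int]_(g.*2)) : 'rV[R[i]]_g :=
  map_mx intr m *m periods A.

(* The line bundle of [e] is the quotient of V x C by the action
   m . (v, t) = (v + m, e m v * t) of the lattice. *)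
Definition factor_of_automorphy
    (e : 'rV[int]_(g.*2) -> 'rV[R[i]]_g -> R[i]^o) : Prop :=
  [/\ forall m, holomorphic (e m),
      forall m v, e m v != 0
    & forall m n v, e (m + n) v = e m (lattice_point n + v) * e n v].

Definition alt_form (E : 'M[int]_(g.*2)) (m n : 'rV[int]_(g.*2)) : int :=
  (m *m E *m n^T) 0 0.

(* [E] represents c_1 of the line bundle of [e]: writing
   e_m = exp(2 pi i f_m) with f_m holomorphic, the connecting homomorphism of
   the exponential sequence gives the integral 2-cocycle
   f_n(v + m) - f_(m + n)(v) + f_m(v), whose class in H^2(L, Z) is the
   alternating form obtained by antisymmetrizing it. *)
Definition first_chern_class
    (e : 'rV[int]_(g.*2) -> 'rV[R[i]]_g -> R[i]^o) (E : 'M[int]_(g.*2)) : Prop :=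
  exists f : 'rV[int]_(g.*2) -> 'rV[R[i]]_g -> R[i]^o,
    [/\ forall m, holomorphic (f m),
        forall m v, e m v = cexp ((pi *+ 2)%:C * 'i%C * f m v)
      & forall m n v,
          (alt_form E m n)%:~R =
            f n (v + lattice_point m) + f m v
            - f m (v + lattice_point n) - f n v :> R[i]].

Definition neron_severi : set 'M[int]_(g.*2) :=
  [set E | exists e, factor_of_automorphy e /\ first_chern_class e E].

(* The Hermitian form of [E] is H(x, y) = E(ix, y) + i E(x, y), with [E]
   extended R-bilinearly to V; it is positive definite when
   H(x, x) = E(ix, x) > 0 for all x <> 0. Here s and t are the real
   coordinates of x and of ix. *)
Definition positive_definite (E : 'M[int]_(g.*2)) : Prop :=
  forall s t : 'rV[R]_(g.*2),
    real_point t = 'i%C *: real_point s -> s != 0 ->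
    0 < (t *m map_mx intr E *m s^T) 0 0.

Definition abelian_variety : Prop :=
  exists E, neron_severi E /\ positive_definite E.

Definition picard_number (rho : nat) : Prop := has_rank neron_severi rho.

End LineBundles.

Definition picard_set (R : realType) (g : nat) : set nat :=
  if g == 0%N then [set 0%N] else
  [set rho | exists A : complexTorus R g,
     abelian_variety A /\ picard_number A rho].

(* Only used for n <= g, where the subtraction is not truncated. *)
Definition picard_stratum (R : realType) (g n : nat) : set nat :=
  [set ((g - n) ^ 2 + x)%N | x in picard_set R n].

(* Main.v *)
Require Import Defs.
From mathcomp Require Import all_boot all_order all_algebra.
From mathcomp Require Import all_classical all_reals all_analysis.
From HB Require Import structures.
From mathcomp Require Import complex ring lra zify.

(* Over Q, the Neron-Severi space of a torus consists of the alternating rational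
   forms E on the lattice that are invariant under multiplication by i. That
   first Chern classes are invariant is shown without Hodge theory: a Goursat
   bisection on grid means of difference quotients gives Stokes' theorem for the
   holomorphic functions f_m on the faces of the fundamental cube, and the
   increments of the f_m add up there to the (0,2)-part of E.

   Let A be polarized of dimension g. For rational d > 0 the rational vectors x
   such that sqrt(d) * i * x is rational form a subtorus isogenous to E_d^k, with
   E_d the elliptic curve with multiplication by sqrt(-d). It has no homomorphism
   to its orthogonal complement B, so rho(A) = k^2 + rho(B), and rho(B) <= n^2 with
   n = g - k. If all these k are at most N, evaluating forms at one vector at a
   time shows 2 rho(A) <= g (g + N + 2). Hence rho(A) > (g - l)^2 with g large
   forces k > g - 4 l - 2 for some d, and then n <= l. Conversely, for B of
   dimension n, all but finitely many primes p satisfy Hom(E_p, B) = 0, and then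
   E_p^(g-n) x B has Picard number (g - n)^2 + rho(B). *)

Set Implicit Arguments.
Unset Strict Implicit.
Unset Printing Implicit Defensive.
Import Order.TTheory GRing.Theory Num.Theory numFieldNormedType.Exports.

Local Open Scope classical_set_scope.
Local Open Scope ring_scope.
Local Open Scope complex_scope.

(** * Subspaces and dimension counts *)

(** The constants come from comparing squares. For N = g - 4 l - 2 the bound reads rho <= g (g - 2
    l) = (g - l)^2 - l^2, just below the range in question. By itself this leaves n <= 4 l + 1. But
    n > l would give rho <= (g - l - 1)^2 + (4 l + 1)^2, and the step 2 (g - l) - 1 between
    consecutive squares beats the last term once g >= l + (4 l + 2)^2. The same gap between squares
    separates the strata.

    Rational forms suffice because a group of integral forms of full rank has the rational dimension
    as its rank: it is enough to realize the double of each integral invariant form by a line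
    bundle, and for doubles the trivial semicharacter works.

    Bisection is the tool for Stokes because holomorphic means differentiable at every point: no
    continuity of the derivatives is at hand that would allow integrating them over a face. *)

Lemma ex_max_bounded (P : nat -> Prop) (n b : nat) :
  P n -> (forall k, P k -> (k <= b)%N) ->
  exists2 k, P k & forall j, P j -> (j <= k)%N.
Proof.
move=> Pn Pb; have ex : exists k, (fun k => `[< P k >]) k by exists n; apply/asboolP.
have bd k : `[< P k >] -> (k <= b)%N by move/asboolP/Pb.
case: (ex_maxnP ex bd) => k /asboolP Pk max_k.
by exists k => // j Pj; apply: max_k; apply/asboolP.
Qed.

(** A subspace of maximal dimension inside [P] is already all of [P]. This turns conditions that
    mention real matrices into finite-dimensional rational spaces. *)
Lemma subspace_vspace (F : fieldType) (vT : vectType F) (P : vT -> Prop) :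
  P 0 -> (forall a x y, P x -> P y -> P (a *: x + y)) ->
  exists U : {vspace vT}, forall x, x \in U <-> P x.
Proof.
move=> P0 PD.
pose S n := exists U : {vspace vT}, \dim U = n /\ forall x, x \in U -> P x.
have S0 : S 0%N.
  by exists 0%VS; split=> [|x]; rewrite ?dimv0 // memv0 => /eqP->.
have Sb k : S k -> (k <= \dim {:vT})%N.
  by move=> [U [<- _]]; rewrite dimvS ?subvf.
have [k [U [dU PU]] maxk] := ex_max_bounded S0 Sb.
exists U => x; split=> [/PU//|Px]; apply/contraT => nUx.
suff: (\dim (U + <[x]>) <= k)%N.
  rewrite -dU => le; have /eqP : (U == U + <[x]>)%VS by rewrite eqEdim addvSl le.
  move=> eU; case/negP: nUx; rewrite eU.
  by apply: (subvP (addvSr U <[x]>)); apply: memv_line.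
apply: maxk; exists (U + <[x]>)%VS; split=> // _ /memv_addP[y /PU Py [_ /vlineP[a ->] ->]].
by rewrite addrC; apply: PD.
Qed.

Lemma subspace_mx (F : fieldType) (m : nat) (P : 'rV[F]_m -> Prop) :
  P 0 -> (forall a x y, P x -> P y -> P (a *: x + y)) ->
  exists r (X : 'M[F]_(r, m)), row_free X /\ forall x : 'rV_m, (x <= X)%MS <-> P x.
Proof.
move=> P0 PD.
pose S n := exists X : 'M[F]_m, \rank X = n /\ forall x : 'rV_m, (x <= X)%MS -> P x.
have S0 : S 0%N.
  by exists 0; split=> [|x]; rewrite ?mxrank0 // submx0 => /eqP->.
have Sb k : S k -> (k <= m)%N by move=> [U [<- _]]; apply: rank_leq_row.
have [k [X [dX PX]] maxk] := ex_max_bounded S0 Sb.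
exists (\rank X), (row_base X); split=> [|x]; first exact: row_base_free.
rewrite eq_row_base; split=> [/PX//|Px]; apply/contraT => nXx.
suff: (\rank (X + x)%MS <= k)%N.
  rewrite -dX leqNgt => /negP[]; apply: rank_ltmx.
  by rewrite /ltmx addsmxSl /= addsmx_sub submx_refl.
apply: maxk; exists (X + x)%MS; split=> // y /sub_addsmxP[[u v] /= ->].
rewrite [v]mx11_scalar mul_scalar_mx addrC; apply: PD => //.
by apply: PX; apply: submxMl.
Qed.

(** Rank-nullity as an inequality, with [h] injective on the kernel of [f]. Linearity is a
    hypothesis so that matrix expressions can be passed as plain functions. *)
Lemma dim_kernel_bound (F : fieldType) (aT rT sT : vectType F) (f : aT -> rT)
    (h : aT -> sT) (U : {vspace aT}) (V : {vspace rT}) (W : {vspace sT}) :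
  linear f -> linear h ->
  (forall x, x \in U -> f x \in V) ->
  (forall x, x \in U -> f x = 0 -> h x \in W) ->
  (forall x, x \in U -> f x = 0 -> h x = 0 -> x = 0) ->
  (\dim U <= \dim V + \dim W)%N.
Proof.
move=> lf lh fV hW inj.
pose F1 := GRing.isLinear.Build _ _ _ _ f lf.
pose F2 := GRing.isLinear.Build _ _ _ _ h lh.
pose f' : {linear aT -> rT} := HB.pack f F1.
pose h' : {linear aT -> sT} := HB.pack h F2.
rewrite -(limg_ker_dim (linfun f') U) addnC leq_add //.
  by apply: dimvS; apply/subvP=> _ /memv_imgP[x Ux ->]; rewrite lfunE /= fV.
set K := (U :&: _)%VS.
have KP x : x \in K -> x \in U /\ f x = 0.
  by rewrite memv_cap memv_ker lfunE /= => /andP[-> /eqP].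
rewrite -(@limg_dim_eq _ _ _ (linfun h') K).
  by apply: dimvS; apply/subvP=> _ /memv_imgP[x /KP[Ux fx] ->]; rewrite lfunE /= hW.
apply/eqP; rewrite -subv0; apply/subvP=> x.
rewrite memv_cap memv_ker lfunE /= memv0 => /andP[/KP[Ux fx] /eqP hx].
by apply/eqP/inj.
Qed.

Lemma dim_inj_bound (F : fieldType) (aT rT : vectType F) (f : aT -> rT)
    (U : {vspace aT}) (V : {vspace rT}) :
  linear f ->
  (forall x, x \in U -> f x \in V) ->
  (forall x, x \in U -> f x = 0 -> x = 0) ->
  (\dim U <= \dim V)%N.
Proof.
move=> lf fV inj.
have := @dim_kernel_bound _ _ _ _ f f U V 0%VS lf lf fV.
rewrite dimv0 addn0; apply=> [x _ ->|x Ux fx _]; first exact: mem0v.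
exact: inj.
Qed.

Lemma dim_sum_bound (F : fieldType) (aT bT rT : vectType F) (f : aT -> rT)
    (h : bT -> rT) (U : {vspace aT}) (V : {vspace bT}) (W : {vspace rT}) :
  linear f -> linear h ->
  (forall x, x \in U -> f x \in W) -> (forall y, y \in V -> h y \in W) ->
  (forall x y, f x = h y -> x = 0 /\ y = 0) ->
  (\dim U + \dim V <= \dim W)%N.
Proof.
move=> lf lh fW hW inj.
pose F1 := GRing.isLinear.Build _ _ _ _ f lf.
pose F2 := GRing.isLinear.Build _ _ _ _ h lh.
pose f' : {linear aT -> rT} := HB.pack f F1.
pose h' : {linear bT -> rT} := HB.pack h F2.
have f'0 : f 0 = 0 := linear0 f'.
have h'0 : h 0 = 0 := linear0 h'.
have f0 x : x \in U -> linfun f' x = 0 -> x = 0.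
  by rewrite lfunE /= => _ fx; have [] := inj x 0; rewrite ?f'0 ?h'0.
have h0 x : x \in V -> linfun h' x = 0 -> x = 0.
  by rewrite lfunE /= => _ fx; have [] := inj 0 x; rewrite ?f'0 ?h'0.
have dU : \dim (linfun f' @: U) = \dim U.
  apply: limg_dim_eq; apply/eqP; rewrite -subv0; apply/subvP=> x.
  by rewrite memv_cap memv_ker memv0 => /andP[/f0 h1 /eqP /h1 ->].
have dV : \dim (linfun h' @: V) = \dim V.
  apply: limg_dim_eq; apply/eqP; rewrite -subv0; apply/subvP=> x.
  by rewrite memv_cap memv_ker memv0 => /andP[/h0 h1 /eqP /h1 ->].
rewrite -dU -dV -dimv_disjoint_sum; last first.
  apply/eqP; rewrite -subv0; apply/subvP=> x; rewrite memv_cap memv0.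
  case/andP=> /memv_imgP[a _ ->] /memv_imgP[b _]; rewrite !lfunE /=.
  by move=> /inj[-> _]; rewrite f'0.
apply: dimvS; apply/subvP=> _ /memv_addP[_ /memv_imgP[x Ux ->] [_ /memv_imgP[y Uy ->] ->]].
by rewrite !lfunE /= memvD ?fW ?hW.
Qed.

(** * Rational invariant forms and isogenies *)

Section Forms.
Variable R : realType.

Notation rmx A := (map_mx (ratr : rat -> R) A).

(* A torus is encoded by the real matrix [J] of multiplication by [i] in a basis
   of its lattice, acting on row vectors; [nsform J] is the rational
   Neron-Severi space and [posform J E] says that [E (i x, x) > 0]. *)
Definition cplx m (J : 'M[R]_m) := J *m J = - 1%:M.
Definition nsform m (J : 'M[R]_m) (E : 'M[rat]_m) :=
  E^T = - E /\ J *m rmx E *m J^T = rmx E.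
Definition posform m (J : 'M[R]_m) (E : 'M[rat]_m) :=
  forall s : 'rV[R]_m, s != 0 -> 0 < (s *m J *m rmx E *m s^T) 0 0.
Definition polarized m (J : 'M[R]_m) := exists E, nsform J E /\ posform J E.

Lemma nsform0 m (J : 'M[R]_m) : nsform J 0.
Proof. by split; rewrite ?trmx0 ?oppr0 // map_mx0 mulmx0 mul0mx. Qed.

Lemma nsformD m (J : 'M[R]_m) a E1 E2 :
  nsform J E1 -> nsform J E2 -> nsform J (a *: E1 + E2).
Proof.
move=> [t1 j1] [t2 j2]; split; first by rewrite linearD linearZ /= t1 t2 scalerN opprD.
by rewrite map_mxD map_mxZ mulmxDr mulmxDl -scalemxAr -scalemxAl j1 j2.
Qed.

Definition nsv m (J : 'M[R]_m) : {vspace 'M[rat]_m} :=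
  sval (cid (subspace_vspace (nsform0 J) (@nsformD m J))).

Lemma nsvP m (J : 'M[R]_m) E : E \in nsv J <-> nsform J E.
Proof. by rewrite /nsv; case: cid => U /= ->. Qed.

Definition rho m (J : 'M[R]_m) := \dim (nsv J).

(* Isogeny of tori: rational matrices intertwining the complex structures. *)
Definition isog m1 m2 (J1 : 'M[R]_m1) (J2 : 'M[R]_m2) :=
  exists P : 'M[rat]_(m1, m2), exists Q : 'M[rat]_(m2, m1),
    [/\ P *m Q = 1%:M, Q *m P = 1%:M & J1 *m rmx P = rmx P *m J2].

Lemma isog_sym m1 m2 (J1 : 'M[R]_m1) (J2 : 'M[R]_m2) : isog J1 J2 -> isog J2 J1.
Proof.
move=> [P [Q [PQ QP JP]]]; exists Q, P; split=> //.
have PQ' : rmx P *m rmx Q = 1%:M by rewrite -map_mxM PQ map_mx1.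
have QP' : rmx Q *m rmx P = 1%:M by rewrite -map_mxM QP map_mx1.
by rewrite -[LHS]mul1mx -QP' mulmxA -[_ *m _ *m J2]mulmxA -JP -!mulmxA PQ' mulmx1.
Qed.

Lemma rat_inv_dim (F : fieldType) m1 m2 (P : 'M[F]_(m1, m2)) Q :
  P *m Q = 1%:M -> Q *m P = 1%:M -> m1 = m2.
Proof.
move=> PQ QP; apply/eqP; rewrite eqn_leq.
have := mxrankM_maxl P Q; have := mxrankM_maxl Q P.
rewrite PQ QP !mxrank1 => h1 h2.
by rewrite (leq_trans h2 (rank_leq_col _)) (leq_trans h1 (rank_leq_col _)).
Qed.

Lemma isog_dim m1 m2 (J1 : 'M[R]_m1) (J2 : 'M[R]_m2) : isog J1 J2 -> m1 = m2.
Proof. by move=> [P [Q [PQ QP _]]]; apply: rat_inv_dim PQ QP. Qed.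

Lemma nsform_pull m1 m2 (J1 : 'M[R]_m1) (J2 : 'M[R]_m2) (P : 'M[rat]_(m1, m2)) E :
  J1 *m rmx P = rmx P *m J2 -> nsform J2 E -> nsform J1 (P *m E *m P^T).
Proof.
move=> JP [tE jE]; split.
  by rewrite !trmx_mul trmxK tE mulNmx mulmxN mulmxA.
rewrite !map_mxM -map_trmx !mulmxA JP -!mulmxA -trmx_mul JP trmx_mul.
by rewrite !mulmxA -!(mulmxA (rmx P)) jE.
Qed.

Lemma posform_pull m1 m2 (J1 : 'M[R]_m1) (J2 : 'M[R]_m2) (P : 'M[rat]_(m1, m2)) E :
  J1 *m rmx P = rmx P *m J2 -> row_free P -> posform J2 E -> posform J1 (P *m E *m P^T).
Proof.
move=> JP Pf pE s s0; have := pE (s *m rmx P).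
rewrite !map_mxM -map_trmx trmx_mul !mulmxA -!(mulmxA s) JP; apply.
by rewrite mulmx_free_eq0 ?row_free_map.
Qed.

Lemma polarized_sub m1 m2 (J1 : 'M[R]_m1) (J2 : 'M[R]_m2) (P : 'M[rat]_(m1, m2)) :
  J1 *m rmx P = rmx P *m J2 -> row_free P -> polarized J2 -> polarized J1.
Proof.
move=> JP Pf [E [nE pE]]; exists (P *m E *m P^T).
by split; [apply: nsform_pull JP nE | apply: posform_pull JP Pf pE].
Qed.

Lemma cplx_sub m1 m2 (J1 : 'M[R]_m1) (J2 : 'M[R]_m2) (P : 'M[rat]_(m1, m2)) :
  J1 *m rmx P = rmx P *m J2 -> row_free P -> cplx J2 -> cplx J1.
Proof.
rewrite /cplx => JP Pf J22; apply: (@row_free_inj _ _ _ _ (rmx P)).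
  by rewrite row_free_map.
by rewrite -mulmxA JP mulmxA JP -mulmxA J22 mulmxN mulNmx mulmx1 mul1mx.
Qed.

Lemma mulmx1_free (F : fieldType) m1 m2 (P : 'M[F]_(m1, m2)) Q :
  P *m Q = 1%:M -> row_free P.
Proof. by move=> PQ; apply/row_freeP; exists Q. Qed.

Lemma isog_rho m1 m2 (J1 : 'M[R]_m1) (J2 : 'M[R]_m2) : isog J1 J2 -> rho J1 = rho J2.
Proof.
suff H n1 n2 (K1 : 'M[R]_n1) (K2 : 'M[R]_n2) : isog K1 K2 -> (rho K2 <= rho K1)%N.
  by move=> h; apply/eqP; rewrite eqn_leq !H //; apply: isog_sym.
move=> [P [Q [PQ QP JP]]].
apply: (@dim_inj_bound _ _ _ (fun E => P *m E *m P^T)) => [k x y|E|E _].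
    by rewrite linearP /= mulmxDl -scalemxAl.
  by rewrite !nsvP; apply: nsform_pull.
move/(congr1 (fun X => Q *m X *m Q^T)).
by rewrite mulmx0 mul0mx -!mulmxA -trmx_mul QP trmx1 mulmx1 mulmxA QP mul1mx.
Qed.

Lemma cplx_even m (J : 'M[R]_m) : cplx J -> ~~ odd m.
Proof.
move=> JJ; apply/negP => om.
have := congr1 determinant JJ; rewrite det_mulmx -scaleN1r detZ det1 mulr1.
rewrite -signr_odd om expr1 => h; have := sqr_ge0 (\det J).
by rewrite expr2 h lerNr oppr0 ler10.
Qed.

Lemma nsform_anti m (J : 'M[R]_m) E : cplx J -> nsform J E ->
  J *m rmx E = - (rmx E *m J^T).
Proof.
move=> JJ [_ jE]; rewrite -{2}jE -mulmxA -trmx_mul JJ linearN /= trmx1 mulmxN.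
by rewrite opprK mulmx1.
Qed.

Lemma posform_unit m (J : 'M[R]_m) E : posform J E -> E \in unitmx.
Proof.
move=> pE; rewrite -row_free_unit -(row_free_map (ratr : {rmorphism rat -> R})).
rewrite row_free_unit -unitmx_tr -row_free_unit -kermx_eq0; apply/rowV0P=> s.
move=> /sub_kermxP sE; apply/eqP/contraT => /pE.
by rewrite -mulmxA -[rmx E *m _]trmxK trmx_mul trmxK sE trmx0 mulmx0 mxE ltxx.
Qed.

End Forms.

(** * Orthogonal complements *)

Section Splitting.
Variable R : realType.
Notation rmx A := (map_mx (ratr : rat -> R) A).

(** Poincare reducibility. The orthogonal complement under a polarization is stable because [J] is
    skew-adjoint for [E], and it meets the span of [X] trivially because a common vector [z] would
    satisfy [E (z J, z) = 0]. *)
Lemma orthogonal_split m b (J : 'M[R]_m) (X : 'M[rat]_(b, m)) (J1 : 'M[R]_b) :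
  cplx J -> polarized J -> row_free X -> J1 *m rmx X = rmx X *m J ->
  exists c, exists Y : 'M[rat]_(c, m), exists J2 : 'M[R]_c,
    exists Q : 'M[rat]_(m, b + c),
    [/\ J2 *m rmx Y = rmx Y *m J, col_mx X Y *m Q = 1%:M & Q *m col_mx X Y = 1%:M].
Proof.
move=> JJ [E [nE pE]] Xf JX.
set KE := E *m X^T; set Y := row_base (kermx KE).
have Eu := posform_unit pE.
have rKE : \rank KE = b.
  rewrite -mxrank_tr trmx_mul trmxK mxrankMfree; first exact/eqP.
  by rewrite row_free_unit unitmx_tr.
have YE : Y *m KE = 0 by apply/sub_kermxP; rewrite eq_row_base.
have rYE : rmx Y *m rmx E *m (rmx X)^T = 0.
  by rewrite map_trmx -!map_mxM -mulmxA YE map_mx0.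
have /submxP[J2 JY] : (rmx Y *m J <= rmx Y)%MS.
  apply: (@submx_trans _ _ _ _ _ _ (rmx (kermx KE))); last by rewrite map_submx eq_row_base.
  rewrite map_kermx; apply/sub_kermxP.
  rewrite [rmx KE]map_mxM mulmxA -(mulmxA _ J) (nsform_anti JJ nE) mulmxN mulNmx -!mulmxA.
  by rewrite -map_trmx -trmx_mul -JX trmx_mul !mulmxA rYE mul0mx oppr0.
exists (\rank (kermx KE)), Y, J2.
have bc : (b + \rank (kermx KE))%N = m.
  by rewrite mxrank_ker rKE subnKC // -rKE rank_leq_row.
have Cf : row_free (col_mx X Y).
  rewrite -kermx_eq0; apply/rowV0P => s /sub_kermxP.
  rewrite -[s]hsubmxK mul_row_col => /eqP; rewrite addr_eq0 => /eqP XY.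
  set z := lsubmx s *m X in XY.
  have [z0|z0] := eqVneq z 0; last first.
    have := pE (rmx z); rewrite map_mx_eq0 => /(_ z0).
    rewrite {1}/z XY map_mxN map_mxM -(mulmxA _ _ J) -JX linearN mulmxN /= map_mxM trmx_mul.
    rewrite !mulmxA -!(mulmxA (_ *m J1)).
    have -> : rmx X *m rmx E *m (rmx Y)^T = 0.
      apply: trmx_inj; rewrite trmx0 !trmx_mul trmxK mulmxA.
      by rewrite [(rmx E)^T]map_trmx nE.1 map_mxN mulmxN mulNmx rYE oppr0.
    by rewrite mul0mx mulmx0 oppr0 mxE ltxx.
  have /eqP := z0; rewrite mulmx_free_eq0 // => /eqP ->.
  have /eqP : rsubmx s *m Y = 0 by apply/eqP; rewrite -oppr_eq0 -XY z0.
  by rewrite mulmx_free_eq0 ?row_base_free // => /eqP ->; rewrite row_mx0.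
have Cu : row_full (col_mx X Y) by rewrite /row_full (eqP Cf) bc.
case/row_freeP: (Cf) => Q CQ; exists Q; split=> //.
by case/row_fullP: Cu => Q' QC; rewrite -[Q]mul1mx -QC -(mulmxA Q') CQ mulmx1.
Qed.

Definition dsum m1 m2 (J1 : 'M[R]_m1) (J2 : 'M[R]_m2) : 'M[R]_(m1 + m2) :=
  block_mx J1 0 0 J2.

Lemma split_isog m b c (J : 'M[R]_m) (X : 'M[rat]_(b, m)) (J1 : 'M[R]_b)
    (Y : 'M[rat]_(c, m)) (J2 : 'M[R]_c) Q :
  J1 *m rmx X = rmx X *m J -> J2 *m rmx Y = rmx Y *m J ->
  col_mx X Y *m Q = 1%:M -> Q *m col_mx X Y = 1%:M -> isog (dsum J1 J2) J.
Proof.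
move=> JX JY CQ QC; exists (col_mx X Y), Q; split=> //.
by rewrite map_col_mx mul_block_col mul_col_mx !mul0mx addr0 add0r JX JY.
Qed.

Lemma cplx_dsum m1 m2 (J1 : 'M[R]_m1) (J2 : 'M[R]_m2) :
  cplx J1 -> cplx J2 -> cplx (dsum J1 J2).
Proof.
rewrite /cplx => h1 h2; rewrite /dsum mulmx_block !mul0mx !mulmx0 !addr0 !add0r h1 h2.
by rewrite scalar_mx_block opp_block_mx !oppr0.
Qed.

Lemma polarized_dsum m1 m2 (J1 : 'M[R]_m1) (J2 : 'M[R]_m2) :
  polarized J1 -> polarized J2 -> polarized (dsum J1 J2).
Proof.
move=> [E1 [[t1 j1] p1]] [E2 [[t2 j2] p2]].
have JE : dsum J1 J2 *m rmx (block_mx E1 0 0 E2) = block_mx (J1 *m rmx E1) 0 0 (J2 *m rmx E2).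
  by rewrite map_block_mx !map_mx0 mulmx_block !mul0mx !mulmx0 !addr0 !add0r.
exists (block_mx E1 0 0 E2); split; first split.
- by rewrite tr_block_mx !trmx0 t1 t2 opp_block_mx !oppr0.
- rewrite JE tr_block_mx !trmx0 mulmx_block !mul0mx !mulmx0 !addr0 !add0r j1 j2.
  by rewrite map_block_mx !map_mx0.
move=> s s0; rewrite -mulmxA -mulmxA (mulmxA (dsum J1 J2)) JE.
have -> : s *m (block_mx (J1 *m rmx E1) 0 0 (J2 *m rmx E2) *m s^T) =
    lsubmx s *m J1 *m rmx E1 *m (lsubmx s)^T + rsubmx s *m J2 *m rmx E2 *m (rsubmx s)^T.
  rewrite -{1 2}[s]hsubmxK tr_row_mx mulmxA mul_row_block !mulmx0 addr0 add0r.
  by rewrite mul_row_col !mulmxA.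
rewrite mxE; have [l0|l0] := eqVneq (lsubmx s) 0.
  rewrite l0 !mul0mx [X in X + _]mxE add0r; apply: p2.
  by apply: contraNneq s0 => r0; rewrite -[s]hsubmxK l0 r0 row_mx0.
have [->|r0] := eqVneq (rsubmx s) 0; last by rewrite addr_gt0 ?p1 ?p2.
rewrite !mul0mx [X in _ + X]mxE addr0.
exact: p1.
Qed.

(* No nonzero homomorphism from one torus to the dual of the other, hence no
   mixed classes in the Neron-Severi space of the product. *)
Definition unrelated m1 m2 (J1 : 'M[R]_m1) (J2 : 'M[R]_m2) :=
  forall M : 'M[rat]_(m1, m2), J1 *m rmx M *m J2^T = rmx M -> M = 0.

Lemma nsform_block m1 m2 (J1 : 'M[R]_m1) (J2 : 'M[R]_m2) a b c e :
  nsform (dsum J1 J2) (block_mx a b c e) <->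
  [/\ nsform J1 a, nsform J2 e, c = - b^T & J1 *m rmx b *m J2^T = rmx b].
Proof.
rewrite /nsform /dsum tr_block_mx opp_block_mx map_block_mx !tr_block_mx !trmx0.
rewrite !mulmx_block !mul0mx !mulmx0 !addr0 !add0r; split.
  move=> [/eq_block_mx[ta tc tb te] /eq_block_mx[ja jb jc je]].
  by split=> //; rewrite tb opprK.
move=> [[ta ja] [te je] -> jb]; split.
  by rewrite ta te linearN /= trmxK opprK.
rewrite ja je jb map_mxN -map_trmx mulmxN mulNmx; congr (block_mx _ _ (- _) _).
by rewrite -{2}jb !trmx_mul trmxK mulmxA.
Qed.

Lemma rho_dsum m1 m2 (J1 : 'M[R]_m1) (J2 : 'M[R]_m2) :
  unrelated J1 J2 -> rho (dsum J1 J2) = (rho J1 + rho J2)%N.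
Proof.
move=> un; apply/eqP; rewrite eqn_leq; apply/andP; split.
  apply: (@dim_kernel_bound _ _ _ _ ulsubmx drsubmx) => [k x y|k x y|E|E|E].
  - by apply/matrixP=> i j; rewrite !mxE.
  - by apply/matrixP=> i j; rewrite !mxE.
  - by rewrite !nsvP -{1}[E]submxK => /nsform_block[].
  - by rewrite !nsvP -{1}[E]submxK => /nsform_block[].
  rewrite nsvP -{1}[E]submxK => /nsform_block[_ _ c /un b] /= a e.
  by rewrite -[E]submxK a e c b trmx0 oppr0 block_mx0.
pose f1 (a : 'M[rat]_m1) : 'M[rat]_(m1 + m2) := block_mx a 0 0 0.
pose f2 (e : 'M[rat]_m2) : 'M[rat]_(m1 + m2) := block_mx 0 0 0 e.
have l1 : linear f1.
  by move=> k x y; rewrite /f1 scale_block_mx !scaler0 add_block_mx !addr0.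
have l2 : linear f2.
  by move=> k x y; rewrite /f2 scale_block_mx !scaler0 add_block_mx !addr0.
apply: (dim_sum_bound l1 l2) => [E|E|a e] /=.
- rewrite !nsvP => nE; apply/nsform_block; split=> //; first exact: nsform0.
    by rewrite trmx0 oppr0.
  by rewrite map_mx0 mulmx0 mul0mx.
- rewrite !nsvP => nE; apply/nsform_block; split=> //; first exact: nsform0.
    by rewrite trmx0 oppr0.
  by rewrite map_mx0 mulmx0 mul0mx.
by move=> /eq_block_mx[-> _ _ <-].
Qed.

End Splitting.

(** * Complex multiplication *)

Lemma free_full_inv (F : fieldType) n m (A : 'M[F]_(n, m)) :
  row_free A -> row_full A -> exists Q, A *m Q = 1%:M /\ Q *m A = 1%:M.
Proof.
case/row_freeP=> Q AQ /row_fullP[Q' QA]; exists Q; split=> //.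
by rewrite -[Q]mul1mx -QA -(mulmxA Q') AQ mulmx1.
Qed.

(* [T] makes the space a vector space over [F(sqrt(-d))]; the rows of [Z] are a basis of it. *)
Lemma quadratic_basis (F : fieldType) (d : F) w (T : 'M[F]_w) :
  (forall a b : F, a ^+ 2 + d * b ^+ 2 = 0 -> a = 0 /\ b = 0) ->
  T *m T = - d%:M ->
  exists k, exists Z : 'M[F]_(k, w), exists Q,
    col_mx Z (Z *m T) *m Q = 1%:M /\ Q *m col_mx Z (Z *m T) = 1%:M.
Proof.
move=> aniso TT.
pose S k := exists Z : 'M[F]_(k, w), row_free (col_mx Z (Z *m T)).
have S0 : S 0%N.
  exists 0; rewrite mul0mx /row_free [col_mx _ _]flatmx0 mxrank0 //.
have Sb k : S k -> (k <= w)%N.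
  move=> [Z /eqP Zf]; have := rank_leq_col (col_mx Z (Z *m T)).
  by rewrite Zf; apply: leq_trans; rewrite leq_addr.
have [k [Z Zf] maxk] := ex_max_bounded S0 Sb.
exists k, Z; apply: free_full_inv => //.
set N := col_mx Z _ in Zf *.
have NT (n : nat) (y : 'M[F]_(n, w)) : (y <= N)%MS -> (y *m T <= N)%MS.
  case/submxP=> D ->; rewrite -mulmxA; apply/(submx_trans (submxMl _ _)).
  have /andP[ZN ZTN] : (Z <= N)%MS && (Z *m T <= N)%MS by rewrite -col_mx_sub.
  rewrite mul_col_mx -mulmxA TT mulmxN mul_mx_scalar col_mx_sub ZTN /=.
  by rewrite eqmx_opp scalemx_sub.
apply/contraT; rewrite -sub1mx => /row_subPn[i0]; move: (row i0 _) => y yN.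
suff: (k.+1 <= k)%N by rewrite ltnn.
apply: (maxk (1 + k)%N); exists (col_mx y Z).
rewrite -kermx_eq0; apply/rowV0P=> s /sub_kermxP.
rewrite -[s]hsubmxK -[lsubmx s]hsubmxK -[rsubmx s]hsubmxK.
move: (lsubmx (lsubmx s)) (rsubmx (lsubmx s)) (lsubmx (rsubmx s)) (rsubmx (rsubmx s)).
move=> a A b B.
rewrite mul_col_mx !mul_row_col [a]mx11_scalar [b]mx11_scalar !mul_scalar_mx.
move: (a 0 0) (b 0 0) => {}a {}b.
rewrite addrACA => h.
have ABN : ((A *m Z + B *m (Z *m T))%R <= N)%MS by rewrite -mul_row_col submxMl.
have xN : ((a *: y + b *: (y *m T))%R <= N)%MS.
  by move/eqP: h; rewrite addr_eq0 => /eqP ->; rewrite eqmx_opp.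
have [|a0 b0] := aniso a b.
  apply/eqP/contraT => nz; case/negP: yN.
  rewrite -(eqmx_scale _ nz).
  (* The conjugate [a - b T] turns [a y + b y T] into a nonzero norm times [y]. *)
  have -> : (a ^+ 2 + d * b ^+ 2) *: y = a *: (a *: y + b *: (y *m T)) -
      b *: ((a *: y + b *: (y *m T)) *m T).
    rewrite mulmxDl -!scalemxAl -mulmxA TT mulmxN mul_mx_scalar.
    by move: (y *m T) => z; apply/rowP=> j; rewrite !mxE; ring.
  by rewrite addmx_sub ?eqmx_opp ?scalemx_sub ?NT.
move: h; rewrite a0 b0 !scale0r !add0r -mul_row_col => /eqP.
rewrite mulmx_free_eq0 // row_mx_eq0 => /andP[/eqP -> /eqP ->].
by rewrite raddf0 !row_mx0.
Qed.

Section CM.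
Variable R : realType.
Notation rmx A := (map_mx (ratr : rat -> R) A).
Notation sq d := (Num.sqrt (ratr d : R)).

(* The rational vectors [x] with [sqrt d * x J] rational: they span the isotypic
   component of the elliptic curve with multiplication by [sqrt (- d)]. *)
Definition cmrow d m (J : 'M[R]_m) (x : 'rV[rat]_m) :=
  exists y : 'rV[rat]_m, sq d *: (rmx x *m J) = rmx y.

(** Multiplication by the square root of [- d] on the [k]-th power of the quadratic field, in the
    basis 1, square root of [- d]. *)
Definition companion (d : rat) k : 'M[rat]_(k + k) := block_mx 0 1%:M (- d%:M) 0.

(* The [k]-th power of the elliptic curve with multiplication by [sqrt (- d)]. *)
Definition stdJ (d : rat) k : 'M[R]_(k + k) := (sq d)^-1 *: rmx (companion d k).

Lemma sq_gt0 (d : rat) : 0 < d -> 0 < sq d.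
Proof. by move=> d0; rewrite sqrtr_gt0 ltr0q. Qed.

Lemma sqK (d : rat) : 0 < d -> sq d * sq d = ratr d.
Proof. by move=> d0; rewrite -expr2 sqr_sqrtr // ler0q ltW. Qed.

Lemma rmx_inj m n : injective (fun A : 'M[rat]_(m, n) => rmx A).
Proof. exact: (@map_mx_inj _ _ (ratr : {rmorphism rat -> R})). Qed.

(** [sqrt d * J] acts on the CM vectors by a rational matrix [T] with [T ^ 2 = - d], so they form a
    vector space over the imaginary quadratic field; in a basis of it [J] becomes [stdJ d k]. *)
Lemma cm_part d m (J : 'M[R]_m) : 0 < d -> cplx J ->
  exists k (X : 'M[rat]_(k + k, m)), [/\ row_free X,
     forall x : 'rV_m, (x <= X)%MS <-> cmrow d J x & stdJ d k *m rmx X = rmx X *m J].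
Proof.
move=> d0 JJ; have sd0 := sq_gt0 d0.
have P0 : cmrow d J 0 by exists 0; rewrite !map_mx0 mul0mx scaler0.
have PD a x y : cmrow d J x -> cmrow d J y -> cmrow d J (a *: x + y).
  move=> [x' hx] [y' hy]; exists (a *: x' + y').
  by rewrite !map_mxD !map_mxZ -hx -hy mulmxDl scalerDr -scalemxAl !scalerA mulrC.
have [w [X [Xf XP]]] := subspace_mx P0 PD.
have [Y hY] : exists Y : 'M[rat]_(w, m), sq d *: (rmx X *m J) = rmx Y.
  have /choice[f fP] i : exists y : 'rV[rat]_m, sq d *: (rmx (row i X) *m J) = rmx y.
    by apply/XP; rewrite row_sub.
  exists (\matrix_i f i); apply/row_matrixP=> i.
  by rewrite -map_row rowK -fP linearZ /= row_mul map_row.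
have /submxP[T YT] : (Y <= X)%MS.
  (* Applying [sqrt d * J] twice multiplies by [- d], so the image of a CM vector is again CM. *)
  apply/row_subP=> i; apply/XP; exists (- d *: row i X).
  rewrite map_row -hY linearZ /= -scalemxAl scalerA sqK // row_mul -mulmxA JJ mulmxN mulmx1.
  by rewrite map_mxZ map_row rmorphN scalerN scaleNr.
have TT : T *m T = - d%:M.
  apply: (row_free_inj Xf); apply: rmx_inj.
  have hTX : rmx T *m rmx X = sq d *: (rmx X *m J) by rewrite hY YT map_mxM.
  rewrite -mulmxA !map_mxM hTX -scalemxAr mulmxA hTX -scalemxAl scalerA sqK //.
  rewrite -mulmxA JJ mulmxN mulmx1 map_mxN map_scalar_mx mulNmx mul_scalar_mx.
  by rewrite scalerN.
have [|k [Z [Q [ZQ QZ]]]] := @quadratic_basis _ d w T _ TT.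
  move=> a b /eqP; rewrite paddr_eq0 ?sqr_ge0 //; last by rewrite mulr_ge0 ?sqr_ge0 ?ltW.
  by rewrite sqrf_eq0 mulf_eq0 sqrf_eq0 (gt_eqF d0) /= => /andP[/eqP-> /eqP->].
set N := col_mx Z _ in ZQ QZ.
have NT : N *m T = companion d k *m N.
  rewrite /companion /N mul_block_col !mul0mx add0r addr0 mul1mx mul_col_mx -mulmxA TT.
  by rewrite mulmxN mulNmx mul_mx_scalar mul_scalar_mx.
exists k, (N *m X); split.
- by apply/row_freeP; case/row_freeP: Xf => X' XX'; exists (X' *m Q);
    rewrite mulmxA -(mulmxA N) XX' mulmx1.
- move=> x; rewrite -XP; split=> [|xX]; first by move/submx_trans; apply; apply: submxMl.
  by apply: submx_trans xX _; rewrite -{1}[X]mul1mx -QZ -mulmxA submxMl.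
rewrite /stdJ -scalemxAl -map_mxM mulmxA -NT -mulmxA -YT map_mxM -hY -scalemxAr.
by rewrite scalerA mulVf ?gt_eqF // scale1r map_mxM mulmxA.
Qed.

Lemma companion_sqr d k : companion d k *m companion d k = - d%:M.
Proof.
rewrite /companion mulmx_block !mul0mx !mulmx0 !add0r !addr0 mul1mx mulmx1.
by rewrite scalar_mx_block opp_block_mx !oppr0.
Qed.

Lemma cplx_stdJ d k : 0 < d -> cplx (stdJ d k).
Proof.
move=> d0; rewrite /cplx /stdJ -scalemxAl -scalemxAr scalerA -map_mxM companion_sqr.
rewrite map_mxN map_scalar_mx scalerN -invfM sqK // scale_scalar_mx mulVf //.
by rewrite gt_eqF // ltr0q.
Qed.

(** The two factors [(sqrt d)^-1] combine to [d^-1], so invariance becomes a rational equation for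
    the companion matrix. *)
Lemma nsform_stdJ d k a b c e : 0 < d ->
  nsform (stdJ d k) (block_mx a b c e) <-> [/\ a^T = - a, b^T = b, c = - b & e = d *: a].
Proof.
move=> d0; have sd0 := sq_gt0 d0.
have -> : nsform (stdJ d k) (block_mx a b c e) <-> (block_mx a b c e)^T = - block_mx a b c e /\
   companion d k *m block_mx a b c e *m (companion d k)^T = d *: block_mx a b c e.
  rewrite /nsform /stdJ linearZ /= -scalemxAr -!scalemxAl scalerA map_trmx -!map_mxM -invfM.
  rewrite sqK //; have dR : (ratr d : R) != 0 by rewrite gt_eqF // ltr0q.
  split=> -[-> h]; split=> //; last by rewrite h map_mxZ scalerA mulVf // scale1r.
  by apply: rmx_inj; rewrite map_mxZ -h scalerA divff // scale1r.
rewrite /companion !tr_block_mx opp_block_mx !trmx0 !linearN /= !tr_scalar_mx.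
rewrite !mulmx_block !mul0mx !mulmx0 !mul1mx !mulmx1 !add0r !addr0.
rewrite !mulmxN !mulNmx !mul_scalar_mx !mul_mx_scalar.
rewrite scale_block_mx; split.
  move=> [/eq_block_mx[ta _ tb _] /eq_block_mx[-> hc _ _]].
  have {}hc : c = - b.
    by apply: (scalerI (lt0r_neq0 d0)); rewrite scalerN -hc opprK.
  by split=> //; rewrite tb hc opprK.
move=> [ta tb -> ->]; split; congr block_mx => //.
- by rewrite linearN /= tb.
- by rewrite opprK.
- by rewrite linearZ /= ta scalerN.
- by rewrite scalerN opprK.
- by rewrite scalerN.
- by rewrite opprK.
Qed.

(** The antisymmetric [a] and the symmetric [b] are the two parts of one arbitrary [k] by [k]
    matrix; the forms are the Hermitian ones over the quadratic field. *)
Lemma rho_stdJ d k : 0 < d -> rho (stdJ d k) = (k * k)%N.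
Proof.
move=> d0; have dM : \dim {:'M[rat]_k} = (k * k)%N by rewrite dimvf.
apply/eqP; rewrite eqn_leq -dM; apply/andP; split.
  apply: (@dim_inj_bound _ _ _ (fun E => ulsubmx E + ursubmx E)) => [n x y|E|E].
  - by apply/matrixP=> i j; rewrite !mxE; ring.
  - by rewrite memvf.
  rewrite nsvP -{1 4}[E]submxK (nsform_stdJ _ _ _ _ d0) => -[ta tb c e].
  move/eqP; rewrite addr_eq0 => /eqP ab.
  have b0 : ursubmx E = 0.
    have : ursubmx E = - ursubmx E.
      by rewrite -{1}tb -[ursubmx E in LHS]opprK -ab linearN /= ta opprK ab.
    move/eqP; rewrite -addr_eq0 -mulr2n -scaler_nat scaler_eq0 pnatr_eq0 /=.
    by move/eqP.
  by rewrite c e ab b0 oppr0 scaler0 block_mx0.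
apply: (@dim_inj_bound _ _ _ (fun M : 'M[rat]_k => block_mx (M - M^T) (M + M^T)
   (- (M + M^T)) (d *: (M - M^T)))) => [n x y|M|M].
- rewrite scale_block_mx add_block_mx.
  by congr block_mx; apply/matrixP=> i j; rewrite !mxE; ring.
- move=> _; apply/nsvP/nsform_stdJ => //; split=> //.
    by rewrite linearB /= trmxK opprB.
  by rewrite linearD /= trmxK addrC.
move=> _ /eqP; rewrite block_mx_eq0 => /and4P[/eqP h1 /eqP h2 _ _].
have /eqP : M + M = 0.
  have -> : M + M = (M - M^T) + (M + M^T) by apply/matrixP=> i j; rewrite !mxE; ring.
  by rewrite h1 h2 addr0.
by rewrite -mulr2n -scaler_nat scaler_eq0 pnatr_eq0 /= => /eqP.
Qed.

Lemma row_norm_gt0 m (s : 'rV[R]_m) : s != 0 -> 0 < (s *m s^T) 0 0.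
Proof.
move=> s0; rewrite mxE lt_neqAle eq_sym; apply/andP; split; last first.
  by apply: sumr_ge0 => i _; rewrite mxE -expr2 sqr_ge0.
apply: contraNneq s0 => /eqP; rewrite psumr_eq0; last first.
  by move=> i _; rewrite mxE -expr2 sqr_ge0.
move/allP=> h; apply/eqP/rowP=> i; rewrite mxE.
by have := h i (mem_index_enum _); rewrite mxE mulf_eq0 orbb => /eqP.
Qed.

Lemma polarized_stdJ d k : 0 < d -> polarized (stdJ d k).
Proof.
(* For [s = (x, y)] this form gives [E (s J, s) = (|x|^2 + d |y|^2) / sqrt d]. *)
move=> d0; exists (block_mx 0 (- 1%:M) 1%:M 0); split.
  apply/nsform_stdJ => //; split; rewrite ?trmx0 ?oppr0 ?scaler0 ?opprK //.
  by rewrite linearN /= tr_scalar_mx.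
move=> s s0.
have -> : s *m stdJ d k *m rmx (block_mx 0 (- 1%:M) 1%:M 0) *m s^T =
    (sq d)^-1 *: (lsubmx s *m (lsubmx s)^T + ratr d *: (rsubmx s *m (rsubmx s)^T)).
  rewrite -(mulmxA s) /stdJ -scalemxAl -map_mxM -scalemxAr -scalemxAl; congr (_ *: _).
  rewrite /companion mulmx_block !mul0mx !mulmx0 !mul1mx !add0r !addr0.
  rewrite mulmxN mulNmx mulmx1 opprK map_block_mx !map_mx0 !map_scalar_mx /=.
  rewrite -{1 2}[s]hsubmxK tr_row_mx mul_row_block !mulmx0 addr0 add0r rmorph1 mulmx1.
  by rewrite mul_row_col mul_mx_scalar -scalemxAl.
rewrite mxE mulr_gt0 ?invr_gt0 ?sq_gt0 // mxE [X in _ + X]mxE.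
have dR : 0 < ratr d :> R by rewrite ltr0q.
have [l0|l0] := eqVneq (lsubmx s) 0.
  rewrite l0 !mul0mx [X in X + _]mxE add0r mulr_gt0 //; apply: row_norm_gt0.
  by apply: contraNneq s0 => r0; rewrite -[s]hsubmxK l0 r0 row_mx0.
have [->|r0] := eqVneq (rsubmx s) 0; last first.
  by apply: addr_gt0; [|apply: mulr_gt0 => //]; apply: row_norm_gt0.
by rewrite !mul0mx [X in _ * X]mxE mulr0 addr0 row_norm_gt0.
Qed.

(** Composed with the inverse of a polarization, a mixed class [M] becomes a homomorphism out of the
    CM torus: the rows of [M *m invmx E] are CM vectors of [J], hence zero. *)
Lemma unrelated_stdJ d k m (J : 'M[R]_m) : 0 < d -> cplx J -> polarized J ->
  (forall x, cmrow d J x -> x = 0) -> unrelated (stdJ d k) J.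
Proof.
move=> d0 JJ [E [nE pE]] noCM M hM; have Eu := posform_unit pE.
have sd0 := sq_gt0 d0.
have h1 : sq d *: (rmx (M *m invmx E) *m J) = rmx (companion d k *m M *m invmx E).
  have EV : rmx E *m rmx (invmx E) = 1%:M by rewrite -map_mxM mulmxV // map_mx1.
  have VE : rmx (invmx E) *m rmx E = 1%:M by rewrite -map_mxM mulVmx // map_mx1.
  have JV : rmx (invmx E) *m J = - (J^T *m rmx (invmx E)).
    rewrite -[LHS]mulmx1 -EV -!mulmxA (mulmxA J) (nsform_anti JJ nE).
    by rewrite mulNmx mulmxN !mulmxA VE mul1mx.
  have h : rmx M *m J^T = - (stdJ d k *m rmx M).
    rewrite -{1}hM -mulmxA -trmx_mul JJ linearN /= trmx1 mulmxN mulmx1 //.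
  rewrite [rmx (M *m _)]map_mxM -mulmxA JV mulmxN mulmxA h mulNmx opprK /stdJ.
  by rewrite -!scalemxAl scalerA divff ?gt_eqF // scale1r -!map_mxM.
have : M *m invmx E = 0.
  apply/row_matrixP=> i; rewrite row0; apply: noCM.
  exists (row i (companion d k *m M *m invmx E)).
  by rewrite map_row -row_mul [RHS]map_row -h1 linearZ.
by move/(congr1 (mulmxr E)); rewrite /= mul0mx mulmxKV.
Qed.

Lemma cmrow_sub d m1 m2 (J1 : 'M[R]_m1) (J2 : 'M[R]_m2) (X : 'M[rat]_(m1, m2)) x :
  J1 *m rmx X = rmx X *m J2 -> cmrow d J1 x -> cmrow d J2 (x *m X).
Proof.
move=> JX [y hy]; exists (y *m X).
by rewrite !map_mxM -mulmxA -JX mulmxA scalemxAl hy.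
Qed.

Lemma cm_split d m (J : 'M[R]_m) : 0 < d -> cplx J -> polarized J ->
  exists k (X : 'M[rat]_(k + k, m)) c (Y : 'M[rat]_(c, m)) (J2 : 'M[R]_c),
   [/\ (forall x : 'rV_m, (x <= X)%MS <-> cmrow d J x) /\ row_free X,
      [/\ cplx J2, polarized J2, J2 *m rmx Y = rmx Y *m J & row_free Y],
      forall y, cmrow d J2 y -> y = 0, isog (dsum (stdJ d k) J2) J
     & rho J = (k * k + rho J2)%N].
Proof.
move=> d0 JJ pJ; have [k [X [Xf XP JX]]] := cm_part d0 JJ.
have [c [Y [J2 [Q [JY CQ QC]]]]] := orthogonal_split JJ pJ Xf JX.
have Yf : row_free Y.
  apply/row_freeP; exists (rsubmx Q); move: CQ.
  rewrite -{1}[Q]hsubmxK mul_col_row scalar_mx_block.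
  by move/eq_block_mx=> [_ _ _].
(* A CM vector of the complement also lies in the span of [X], which meets that of [Y] only in 0. *)
have noCM y : cmrow d J2 y -> y = 0.
  move=> /(cmrow_sub JY)/XP/submxP[D yD].
  have /(congr1 (mulmxr Q)) : row_mx (- D) y *m col_mx X Y = 0.
    by rewrite mul_row_col mulNmx -yD addNr.
  by rewrite /= mul0mx -mulmxA CQ mulmx1 => /eqP; rewrite row_mx_eq0 => /andP[_ /eqP].
have cJ2 : cplx J2 by apply: cplx_sub JY Yf JJ.
have pJ2 : polarized J2 by apply: polarized_sub JY Yf pJ.
have iso := split_isog JX JY CQ QC.
exists k, X, c, Y, J2; split=> //.
by rewrite -(isog_rho iso) rho_dsum ?rho_stdJ //; apply: unrelated_stdJ.
Qed.

End CM.

(** * Bounds on the Picard number *)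

Section Bounds.
Variable R : realType.
Notation rmx A := (map_mx (ratr : rat -> R) A).
Notation sq d := (Num.sqrt (ratr d : R)).

Lemma ex_min_nat (P : nat -> Prop) n : P n -> exists2 k, P k & forall j, P j -> (k <= j)%N.
Proof.
move=> Pn; have ex : exists k, (fun k => `[< P k >]) k by exists n; apply/asboolP.
case: (ex_minnP ex) => k /asboolP Pk mink; exists k => // j Pj.
by apply: mink; apply/asboolP.
Qed.

(* [X] is the smallest subtorus containing [u], so that a form killing [u] kills [X]. *)
Lemma closure_split m (J : 'M[R]_m) (u : 'rV[rat]_m) : cplx J -> polarized J -> u != 0 ->
  exists b (X : 'M[rat]_(b, m)) (J1 : 'M[R]_b) c (Y : 'M[rat]_(c, m)) (J2 : 'M[R]_c),
    [/\ [/\ J1 *m rmx X = rmx X *m J, row_free X, (u <= X)%MS & (1 < b)%N /\ ~~ odd b],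
        [/\ cplx J2, polarized J2, J2 *m rmx Y = rmx Y *m J & row_free Y],
        m = (b + c)%N
      & forall V : {vspace 'rV[rat]_m},
          (forall E, nsform J E -> u *m E \in V) -> (rho J <= \dim V + rho J2)%N].
Proof.
move=> JJ pJ u0.
pose S b := exists (X : 'M[rat]_(b, m)) (J1 : 'M[R]_b),
  [/\ J1 *m rmx X = rmx X *m J, row_free X & (u <= X)%MS].
have Sm : S m.
  exists 1%:M, J; split; first by rewrite map_mx1 mulmx1 mul1mx.
    by rewrite row_free_unit unitmx1.
  by rewrite submx1.
have [b [X [J1 [JX Xf uX]]] minb] := ex_min_nat Sm.
have [c [Y [J2 [Q [JY CQ QC]]]]] := orthogonal_split JJ pJ Xf JX.
have Yf : row_free Y.
  apply/row_freeP; exists (rsubmx Q); move: CQ.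
  rewrite -{1}[Q]hsubmxK mul_col_row scalar_mx_block.
  by move/eq_block_mx=> [_ _ _].
have iso := split_isog JX JY CQ QC.
have b_even : ~~ odd b by apply: cplx_even (cplx_sub JX Xf JJ).
have b_gt1 : (1 < b)%N.
  have : (0 < b)%N.
    rewrite lt0n; apply: contraNneq u0 => b0; move: uX.
    have /eqP : \rank X = 0%N by rewrite (eqP Xf).
    by rewrite mxrank_eq0 => /eqP -> /submx0null ->.
  by case: (b) b_even => [|[|]].
exists b, X, J1, c, Y, J2; split=> //.
- by split=> //; [apply: cplx_sub JY Yf JJ | apply: polarized_sub JY Yf pJ].
- by rewrite (isog_dim iso).
(* The kernel of [E] is stable under [J], so [K] spans a subtorus containing [u], and minimality of
   [b] makes it all of [X]. *)
have XE E : nsform J E -> u *m E = 0 -> X *m E = 0.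
  move=> nE uE; set K := (X :&: kermx E)%MS.
  have uK : (u <= K)%MS by rewrite sub_capmx uX; apply/sub_kermxP.
  have /submxP[JK hJK] : (rmx (row_base K) *m J <= rmx (row_base K))%MS.
    apply: (@submx_trans _ _ _ _ _ _ (rmx K)); last by rewrite map_submx eq_row_base.
    apply: (@submx_trans _ _ _ _ _ _ (rmx K *m J)).
      by apply: submxMr; rewrite map_submx eq_row_base.
    rewrite /K map_capmx sub_capmx; apply/andP; split.
      apply: (@submx_trans _ _ _ _ _ _ (rmx X *m J)); last by rewrite -JX submxMl.
      by apply: submxMr; rewrite map_submx capmxSl.
    rewrite map_kermx; apply/sub_kermxP; rewrite -mulmxA (nsform_anti JJ nE) mulmxN mulmxA.
    by rewrite -map_mxM (sub_kermxP (capmxSr X (kermx E))) map_mx0 mul0mx oppr0.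
  have le : (b <= \rank K)%N.
    by apply: minb; exists (row_base K), JK; rewrite row_base_free eq_row_base.
  have : (X <= K)%MS.
    have := mxrank_leqif_sup (capmxSl X (kermx E)); rewrite -/K => h.
    by rewrite -h eqn_leq h.1 (eqP Xf).
  by rewrite sub_capmx => /andP[_ /sub_kermxP].
move=> V VP; apply: (@dim_kernel_bound _ _ _ _ (mulmx u) (fun E => Y *m E *m Y^T)).
- by move=> k x y; rewrite mulmxDr -scalemxAr.
- by move=> k x y; rewrite mulmxDr -scalemxAr mulmxDl -scalemxAl.
- by move=> E /nsvP/VP.
- by move=> E /nsvP nE _; apply/nsvP; apply: nsform_pull JY nE.
move=> E /nsvP nE uE YEY; have {}XE := XE E nE uE.
have EX : E *m X^T = 0.
  by apply: trmx_inj; rewrite trmx_mul trmxK nE.1 mulmxN XE oppr0 trmx0.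
have CEC : col_mx X Y *m E *m (col_mx X Y)^T = 0.
  rewrite mul_col_mx XE tr_col_mx mul_mx_row !mul_col_mx !mul0mx YEY.
  by rewrite -mulmxA EX mulmx0 !col_mx0 row_mx0.
rewrite -[E]mul1mx -QC -[E]mulmx1 -trmx1 -QC trmx_mul.
by rewrite (mulmxA E) -!mulmxA (mulmxA _ E) (mulmxA _ _ Q^T) CEC mul0mx mulmx0.
Qed.

(** Used with [nsform_self]: [E (u, u) = 0] confines all values [u *m E] to a hyperplane. *)
Lemma orthogonal_dim m (u : 'rV[rat]_m) : u != 0 ->
  exists V : {vspace 'rV[rat]_m}, (\dim V < m)%N /\ forall y, y *m u^T = 0 -> y \in V.
Proof.
move=> u0; pose f := linfun (mulmxr u^T : 'rV[rat]_m -> 'rV_1).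
exists (lker f); split; last by move=> y yu; rewrite memv_ker lfunE /= yu.
have := limg_ker_dim f fullv; rewrite capfv dimvf /dim /= mul1n => dimE.
suff p : (0 < \dim (f @: fullv))%N.
  by apply: leq_trans (eq_leq dimE); rewrite -[ltnLHS]addn0 ltn_add2l.
rewrite lt0n dimv_eq0; apply/eqP => h.
case/eqP: u0; apply/rowP=> i; rewrite mxE.
have : f (delta_mx 0 i) \in (f @: fullv)%VS by rewrite memv_img ?memvf.
rewrite h memv0 lfunE /= -rowE => /eqP/rowP/(_ 0).
by rewrite !mxE.
Qed.

Lemma nsform_self m (J : 'M[R]_m) E (u : 'rV[rat]_m) : nsform J E -> u *m E *m u^T = 0.
Proof.
move=> [tE _]; set x := _ *m _.
have : x = - x.
  rewrite {1}[x]mx11_scalar -tr_scalar_mx -mx11_scalar /x !trmx_mul trmxK tE.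
  by rewrite mulNmx mulmxN mulmxA.
move/eqP; rewrite -addr_eq0 -mulr2n -scaler_nat scaler_eq0 pnatr_eq0 /=.
by move/eqP.
Qed.

Lemma ex_row_neq0 m : (0 < m)%N -> exists u : 'rV[rat]_m, u != 0.
Proof.
case: m => // m _; exists (delta_mx 0 0); apply/eqP => /rowP/(_ 0).
by rewrite !mxE eqxx => /eqP; rewrite oner_eq0.
Qed.

Lemma rho_dim0 (J : 'M[R]_0) : rho J = 0%N.
Proof.
by apply/eqP; rewrite -leqn0 (leq_trans (dimvS (subvf _))) // dimvf.
Qed.

(** For [m = 2 g] this is [rho <= g ^ 2]. Splitting off at least two dimensions loses at most
    [m - 1] dimensions of forms, and [m ^ 2 - (m - 2) ^ 2 = 4 (m - 1)]. *)
Lemma rho_le_sqr m (J : 'M[R]_m) : cplx J -> polarized J -> (4 * rho J <= m ^ 2)%N.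
Proof.
have [n] := ubnP m; elim: n => // n IH in m J *; rewrite ltnS => le_mn JJ pJ.
case: (posnP m) => [m0|m0].
  by move: J JJ pJ {le_mn}; rewrite m0 => J _ _; rewrite rho_dim0.
have [u u0] := ex_row_neq0 m0.
have [b [X [J1 [c [Y [J2 [[_ _ _ [b1 _]] [cJ2 pJ2 _ _] mbc h]]]]]]] := closure_split JJ pJ u0.
have [V [dV VP]] := orthogonal_dim u0.
have {}h := h V (fun E nE => VP _ (nsform_self u nE)).
have cn : (c < n)%N by lia.
have := IH c J2 cn cJ2 pJ2; nia.
Qed.

Lemma no_real_eigenvector m (J : 'M[R]_m) (z : 'rV[R]_m) k :
  cplx J -> z *m J^T = k *: z -> z = 0.
Proof.
move=> JJ h; have : z *m J^T *m J^T = - z.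
  by rewrite -mulmxA -trmx_mul JJ linearN /= trmx1 mulmxN mulmx1.
rewrite h -scalemxAl h scalerA => /eqP; rewrite -addr_eq0 -{2}[z]scale1r -scalerDl.
rewrite scaler_eq0 => /orP[|/eqP //]; rewrite paddr_eq0 ?ler01 //.
  by rewrite oner_eq0 andbF.
by rewrite -expr2 sqr_ge0.
Qed.

(* The image of NS under evaluation at [u] and its image under evaluation at
   [w], where [u], [w] span an elliptic curve, can only meet if that curve has
   complex multiplication. *)
Lemma elliptic_eval_bound m (J : 'M[R]_m) (X : 'M[rat]_(2, m)) (J1 : 'M[R]_2) (u : 'rV[rat]_m) :
  cplx J -> J1 *m rmx X = rmx X *m J -> row_free X -> (u <= X)%MS -> u != 0 ->
  (forall d, 0 < d -> ~ cmrow d J u) ->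
  exists V : {vspace 'rV[rat]_m}, (\dim V + \dim V <= m)%N /\
    forall E, nsform J E -> u *m E \in V.
Proof.
move=> JJ JX Xf uX u0 noCM.
have [w [wX wu]] : exists w : 'rV[rat]_m, (w <= X)%MS /\ ~~ (w <= u)%MS.
  have : ~~ (X <= u)%MS.
    by apply/negP => /mxrankS; rewrite (eqP Xf) leqNgt ltnS rank_leq_row.
  by case/row_subPn=> i h; exists (row i X); rewrite row_sub.
have XC : (X <= col_mx u w)%MS.
  have CX : (col_mx u w <= X)%MS by rewrite col_mx_sub uX.
  rewrite -(mxrank_leqif_sup CX) (eqP Xf) eqn_leq -{1}(eqP Xf) mxrankS //=.
  have /rank_ltmx : (u < col_mx u w)%MS.
    have /andP[uC _] : (u <= col_mx u w)%MS && (w <= col_mx u w)%MS by rewrite -col_mx_sub.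
    by rewrite /ltmx uC col_mx_sub submx_refl /= wu.
  by rewrite rank_rV u0.
have [al [be uJ]] : exists al be : R, rmx u *m J = al *: rmx u + be *: rmx w.
  have : (rmx u *m J <= rmx (col_mx u w))%MS.
    apply: (@submx_trans _ _ _ _ _ _ (rmx X)); last by rewrite map_submx.
    apply: (@submx_trans _ _ _ _ _ _ (rmx X *m J)); last by rewrite -JX submxMl.
    by rewrite submxMr // map_submx.
  case/submxP=> D; rewrite map_col_mx -[D](@hsubmxK _ 1 1 1) mul_row_col.
  rewrite [lsubmx D]mx11_scalar [rsubmx D]mx11_scalar !mul_scalar_mx => ->.
  by do 2 eexists.
have be0 : be != 0.
  apply/eqP => be0; move: uJ; rewrite be0 scale0r addr0 => uJ.
  case/eqP: u0; apply: (@rmx_inj R); rewrite map_mx0.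
  apply: (@no_real_eigenvector _ J^T _ al); rewrite ?trmxK //.
  by rewrite /cplx -trmx_mul JJ linearN /= trmx1.
have key E : nsform J E ->
    al *: rmx (u *m E) + be *: rmx (w *m E) = - (rmx (u *m E) *m J^T).
  move=> nE; rewrite !map_mxM !scalemxAl -mulmxDl -uJ -mulmxA (nsform_anti JJ nE).
  by rewrite mulmxN mulmxA.
pose fu := linfun (mulmx u : 'M[rat]_m -> 'rV_m).
pose fw := linfun (mulmx w : 'M[rat]_m -> 'rV_m).
exists (fu @: nsv J)%VS; split; last first.
  move=> E nE; have <- : fu E = u *m E by rewrite lfunE.
  by apply: memv_img; apply/nsvP.
(* By [key] a form kills [u] exactly when it kills [w], so both evaluations have the same kernel. *)
have dim_eq : \dim (fu @: nsv J) = \dim (fw @: nsv J).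
  apply/eqP; rewrite -(eqn_add2l (\dim (nsv J :&: lker fu))) limg_ker_dim.
  rewrite -(limg_ker_dim fw) eqn_add2r; apply/eqP; congr (\dim _).
  apply/vspaceP=> E; rewrite !memv_cap !memv_ker !lfunE /=.
  case: (boolP (E \in nsv J)) => //= /nsvP/key kE.
  apply/eqP/eqP => h; move: kE; rewrite h map_mx0 ?mul0mx scaler0 ?oppr0 ?add0r ?addr0; last first.
    move/eqP; rewrite scaler_eq0 (negPf be0) /= => /eqP h'.
    by apply: (@rmx_inj R); rewrite h' map_mx0.
  move=> h'; apply: (@rmx_inj R); rewrite map_mx0.
  apply: (@no_real_eigenvector _ J _ (- al)) => //.
  by rewrite scaleNr h' opprK.
rewrite {2}dim_eq -dimv_disjoint_sum; first by rewrite (leq_trans (dimvS (subvf _))) // dimvf /dim /= mul1n.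
apply/eqP; rewrite -subv0; apply/subvP=> z; rewrite memv_cap memv0.
case/andP=> /memv_imgP[E1 /nsvP n1 z1E] /memv_imgP[E2 /nsvP n2 z2E].
move: z1E z2E; rewrite !lfunE /= => z1E z2E.
apply/contraT => z0.
have k1 := key _ n1; have k2 := key _ n2.
move: k1 k2; rewrite -z1E -z2E; set z1 := w *m E1; set z2 := u *m E2 => k1 k2.
have z2_0 : z2 != 0.
  apply: contraNneq z0 => h; move: k2; rewrite h map_mx0 mul0mx scaler0 add0r oppr0.
  move/eqP; rewrite scaler_eq0 (negPf be0) /= => /eqP h'.
  by apply/eqP/(@rmx_inj R); rewrite h' map_mx0.
have z2J : rmx z2 *m J^T = - (al *: rmx z2 + be *: rmx z) by rewrite k2 opprK.
have zJ : rmx z *m J^T = - (al *: rmx z + be *: rmx z1) by rewrite k1 opprK.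
(* [z = u E1 = w E2] is a nonzero common value. As [J^T] squares to [- 1], applying it twice to [z2]
   ties three rational vectors together; independence of [z2] and [z] then makes the coefficients
   rational. *)
have rel : rmx z1 = - ((1 + al ^+ 2) / be ^+ 2) *: rmx z2 + - (2 * (al / be)) *: rmx z.
  have : rmx z2 *m J^T *m J^T = - rmx z2.
    by rewrite -mulmxA -trmx_mul JJ linearN /= trmx1 mulmxN mulmx1.
  rewrite z2J mulNmx mulmxDl -!scalemxAl z2J zJ => /oppr_inj h.
  apply/rowP=> i; move/rowP: h => /(_ i); rewrite !mxE => h.
  move: h; set p := ratr _; set q := ratr _; set r := ratr _ => h.
  have e : be ^+ 2 * r = - (1 + al ^+ 2) * p - 2 * al * be * q.
    apply/eqP; rewrite -subr_eq0; apply/eqP.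
    transitivity (p - (al * - (al * p + be * q) + be * - (al * q + be * r))); first by ring.
    by rewrite h subrr.
  by apply: (mulfI (expf_neq0 2 be0)); rewrite e; field.
have Cf : row_free (col_mx z2 z).
  rewrite -(row_free_map (ratr : {rmorphism rat -> R})) -kermx_eq0.
  apply/rowV0P=> s /sub_kermxP.
  rewrite map_col_mx -[s](@hsubmxK _ 1 1 1) mul_row_col.
  rewrite [lsubmx s]mx11_scalar [rsubmx s]mx11_scalar !mul_scalar_mx.
  move: (lsubmx s 0 0) (rsubmx s 0 0) => s1 s2 h.
  have [s20|s20] := eqVneq s2 0.
    move/eqP: h; rewrite s20 scale0r addr0 scaler_eq0 map_mx_eq0 (negPf z2_0) orbF.
    by move/eqP->; rewrite raddf0 row_mx0.
  case/eqP: z2_0; apply: (@rmx_inj R); rewrite map_mx0.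
  apply: (@no_real_eigenvector _ J _ (- (al - be * (s1 / s2)))) => //.
  have -> : rmx z2 *m J^T = - (al *: rmx z2 + be *: rmx z) by [].
  have -> : rmx z = - (s1 / s2) *: rmx z2.
    apply: (scalerI s20); rewrite scalerA mulrN mulrCA divff // mulr1 scaleNr.
    by apply/eqP; rewrite -addr_eq0 addrC h.
  by rewrite scalerA -scalerDl -scaleNr; congr (_ *: _); ring.
have [p [q [hp hq]]] : exists p q : rat, (1 + al ^+ 2) / be ^+ 2 = ratr p /\ al / be = ratr q.
  have : (z1 <= col_mx z2 z)%MS.
    rewrite -(map_submx (ratr : {rmorphism rat -> R})) map_col_mx rel.
    by rewrite -!mul_scalar_mx -mul_row_col submxMl.
  case/submxP=> D; rewrite -[D](@hsubmxK _ 1 1 1) mul_row_col.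
  rewrite [lsubmx D]mx11_scalar [rsubmx D]mx11_scalar !mul_scalar_mx.
  move: (lsubmx D 0 0) (rsubmx D 0 0) => a b z1D.
  exists (- a), (- b / 2).
  have : row_mx (- ((1 + al ^+ 2) / be ^+ 2) - ratr a)%:M (- (2 * (al / be)) - ratr b)%:M
     *m rmx (col_mx z2 z) = 0 :> 'rV_m.
    rewrite map_col_mx mul_row_col !mul_scalar_mx !scalerBl addrACA -opprD -rel.
    by rewrite z1D map_mxD !map_mxZ subrr.
  move/eqP; rewrite mulmx_free_eq0 ?row_free_map // row_mx_eq0.
  case/andP=> /eqP/matrixP/(_ 0 0) + /eqP/matrixP/(_ 0 0).
  rewrite !mxE eqxx !mulr1n => /eqP ha /eqP hb; split.
    by apply/eqP; rewrite rmorphN /= -subr_eq0 opprK -oppr_eq0 opprD.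
  rewrite fmorph_div rmorphN /= ratr_nat.
  by move: hb; rewrite subr_eq0 => /eqP <-; field.
have dE : ratr (p - q ^+ 2) = be^-1 ^+ 2 :> R.
  by rewrite rmorphB rmorphXn /= -hp -hq; field.
have d0 : 0 < p - q ^+ 2.
  by rewrite -(ltr0q R) dE exprn_even_gt0 //= invr_eq0.
(* Here [sqrt d] is [|be|^-1], so [sqrt d * u J] is [q u + w] up to the sign of [be]. *)
case: (noCM _ d0); exists ((-1) ^+ (be < 0)%R *: (q *: u + w)).
rewrite dE sqrtr_sqr normrEsign invr_lt0 uJ !map_mxZ map_mxD map_mxZ rmorph_sign /= -hq.
by rewrite !scalerDr !scalerA; congr (_ *: _ + _ *: _); field.
Qed.

(* A CM isotypic component of dimension [k] contributes [k ^ 2]. Once none is left,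
   removing [b] of the [m] rational dimensions by [closure_split] contributes at
   most [m / 2] if [b = 2] and at most [m - 1] if [b >= 4]. *)
Lemma rho_le_cm m (J : 'M[R]_m) D : cplx J -> polarized J ->
  (forall d w (X : 'M[rat]_(w, m)), 0 < d -> row_free X ->
     (forall x : 'rV_m, (x <= X)%MS -> cmrow d J x) -> (w <= D)%N) ->
  (8 * rho J <= m * (m + D + 4))%N.
Proof.
have [n] := ubnP m; elim: n => // n IH in m J *; rewrite ltnS => le_mn JJ pJ hD.
have hDsub c (Y : 'M[rat]_(c, m)) (J2 : 'M[R]_c) : J2 *m rmx Y = rmx Y *m J -> row_free Y ->
    forall d w (X : 'M[rat]_(w, c)), 0 < d -> row_free X ->
     (forall x : 'rV_c, (x <= X)%MS -> cmrow d J2 x) -> (w <= D)%N.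
  move=> JY Yf d w X d0 Xf hX; apply: (hD d w (X *m Y)) => //.
    by rewrite /row_free mxrankMfree.
  move=> x /submxP[A ->]; rewrite mulmxA; apply: cmrow_sub JY _; apply: hX.
  exact: submxMl.
have [[d [x [d0 x0 xCM]]]|noCM] :=
    pselect (exists d x, [/\ 0 < d, x != 0 & cmrow d J x]).
  have [k [X [c [Y [J2 [[XP Xf] [cJ2 pJ2 JY Yf] _ /isog_dim mE ->]]]]]] := cm_split d0 JJ pJ.
  have kD : (k + k <= D)%N by apply: (hD d _ X) => // y /XP.
  have k0 : (0 < k)%N.
    rewrite lt0n; apply: contraNneq x0 => k0.
    have /eqP : \rank X = 0%N by rewrite (eqP Xf) k0.
    by rewrite mxrank_eq0 => /eqP X0; move/XP: xCM; rewrite X0 => /submx0null ->.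
  have cn : (c < n)%N by lia.
  (* With [m = 2 k + c] the right-hand side grows by [2 k (2 k + 2 c + D + 4)], at least [8 k ^ 2]
     since [2 k <= D]. *)
  have := IH c J2 cn cJ2 pJ2 (hDsub _ _ _ JY Yf); nia.
case: (posnP m) => [m0|m0].
  by move: J JJ pJ {le_mn hD hDsub noCM}; rewrite m0 => J _ _; rewrite rho_dim0.
have [u u0] := ex_row_neq0 m0.
have [b [X [J1 [c [Y [J2 [[JX Xf uX [b1 bev]] [cJ2 pJ2 JY Yf] mbc h]]]]]]] :=
  closure_split JJ pJ u0.
have cn : (c < n)%N by lia.
have {}IH := IH c J2 cn cJ2 pJ2 (hDsub _ _ _ JY Yf).
case: (ltnP 2 b) => b2.
  have [V [dV VP]] := orthogonal_dim u0.
  have {}h := h V (fun E nE => VP _ (nsform_self u nE)).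
  have b4 : (4 <= b)%N by move: b b2 bev {JX Xf uX mbc X J1 h b1} => [|[|[|[|]]]].
  (* For [b >= 4] the right-hand side grows by at least [8 m + 4 D], against [8 (m - 1)] from
     evaluation at [u]. *)
  by nia.
have bE : b = 2%N by lia.
rewrite bE in X J1 JX Xf uX mbc.
have noCMu d : 0 < d -> ~ cmrow d J u by move=> d0 uCM; apply: noCM; exists d, u.
have [V [dV VP]] := elliptic_eval_bound JJ JX Xf uX u0 noCMu.
by have {}h := h V VP; nia.
Qed.

End Bounds.

(** * Picard numbers of polarized complex structures *)

Section Realizable.
Variable R : realType.
Notation rmx A := (map_mx (ratr : rat -> R) A).
Notation sq d := (Num.sqrt (ratr d : R)).

Lemma cmrow_dsum d m1 m2 (J1 : 'M[R]_m1) (J2 : 'M[R]_m2) x1 x2 :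
  cmrow d (dsum J1 J2) (row_mx x1 x2) -> cmrow d J1 x1 /\ cmrow d J2 x2.
Proof.
move=> [y]; rewrite -[y]hsubmxK !map_row_mx /dsum mul_row_block !mulmx0 addr0 add0r.
rewrite scale_row_mx => /eq_row_mx[h1 h2].
by split; [exists (lsubmx y) | exists (rsubmx y)].
Qed.

(** After clearing denominators, the [p]-adic valuations of the two sides have different parity. *)
Lemma prime_ratio_irrational p q (t : rat) : prime p -> prime q -> p != q ->
  q%:R <> t ^+ 2 * p%:R.
Proof.
move=> pp pq npq h.
have hZ : (q%:Z * denq t ^+ 2 = numq t ^+ 2 * p%:Z)%R.
  apply: (@intr_inj rat); rewrite !expr2 !intrM -!pmulrn h -{1}[t]divq_num_den.
  by field; rewrite intr_eq0 denq_neq0.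
have {}hZ : (q * `|denq t| ^ 2 = `|numq t| ^ 2 * p)%N.
  by move/(congr1 absz): hZ; rewrite !expr2 !abszM !absz_nat !mulnn.
have d0 : (0 < `|denq t|)%N by rewrite absz_gt0 denq_neq0.
have n0 : (0 < `|numq t|)%N.
  by have := prime_gt0 pq; case: (posnP `|numq t|%N) hZ => // -> + q0; nia.
move/(congr1 (logn p)): hZ; rewrite -!mulnn !lognM ?muln_gt0 ?d0 ?n0 ?prime_gt0 //.
rewrite (logn_prime p pp) (logn_prime p pq) eqxx (negPf npq) !addnn => /(congr1 odd).
by rewrite add0n oddD !odd_double.
Qed.

(** On this torus [sqrt q * J] is [sqrt (q / p)] times an invertible rational matrix, so a nonzero
    CM vector would make [sqrt (q / p)] rational. *)
Lemma cmrow_stdJ_prime p q k x : prime p -> prime q -> p != q ->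
  cmrow q%:R (stdJ R p%:R k) x -> x = 0.
Proof.
move=> pp pq npq [y hy].
have p0 : 0 < p%:R :> rat by rewrite ltr0n prime_gt0.
have q0 : 0 < q%:R :> rat by rewrite ltr0n prime_gt0.
set z := x *m companion p%:R k.
have {}hy : (sq q%:R / sq p%:R) *: rmx z = rmx y.
  by rewrite -hy /stdJ -scalemxAr scalerA -map_mxM.
have [z0|/eqP z0] := eqVneq z 0.
  have : z *m companion p%:R k = 0 by rewrite z0 mul0mx.
  rewrite -mulmxA companion_sqr mulmxN mul_mx_scalar => /eqP.
  by rewrite oppr_eq0 scaler_eq0 (gt_eqF p0) => /eqP.
clearbody z; have [j zj] : exists j, z 0 j != 0.
  apply: contrapT => h; apply: z0; apply/rowP=> j; rewrite [RHS]mxE.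
  by apply: contrapT => /eqP zj; apply: h; exists j.
exfalso; apply: (@prime_ratio_irrational p q (y 0 j / z 0 j)) => //.
apply: (fmorph_inj (ratr : {rmorphism rat -> R})).
have e : sq q%:R / sq p%:R = ratr (y 0 j / z 0 j).
  move/rowP: hy => /(_ j); rewrite !mxE => e.
  by rewrite fmorph_div /= -e mulfK // fmorph_eq0.
rewrite rmorphM rmorphXn /= -e expr_div_n !expr2 !sqK //= divfK //.
by rewrite gt_eqF // ltr0q.
Qed.

(** Induction on the dimension: a prime with a nonzero CM vector splits off its isotypic component,
    on which no other prime has one. The bound [p.+1] excludes that prime itself. *)
Lemma cm_primes_bounded m (J : 'M[R]_m) : cplx J -> polarized J ->
  exists N, forall p, prime p -> (N <= p)%N -> forall x, cmrow p%:R J x -> x = 0.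
Proof.
have [n] := ubnP m; elim: n => // n IH in m J *; rewrite ltnS => le_mn JJ pJ.
have [[p [x [pp x0 xCM]]]|noCM] :=
    pselect (exists p x, [/\ prime p, x != 0 & cmrow p%:R J x]); last first.
  exists 0%N => p pp _ x xCM; apply/eqP/contraT => x0.
  by case: noCM; exists p, x.
have p0 : 0 < p%:R :> rat by rewrite ltr0n prime_gt0.
have [k [X [c [Y [J2 [[XP Xf] [cJ2 pJ2 _ _] _ iso _]]]]]] := cm_split p0 JJ pJ.
have k0 : (0 < k)%N.
  rewrite lt0n; apply: contraNneq x0 => k0.
  have /eqP : \rank X = 0%N by rewrite (eqP Xf) k0.
  by rewrite mxrank_eq0 => /eqP X0; move/XP: xCM; rewrite X0 => /submx0null ->.
have cn : (c < n)%N by have := isog_dim iso; lia.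
have [N hN] := IH c J2 cn cJ2 pJ2.
exists (maxn N p.+1) => q pq; rewrite geq_max => /andP[Nq ltpq] z zCM.
have [P [Q' [PQ QP JP]]] := isog_sym iso.
have := cmrow_sub JP zCM; rewrite -[z *m P]hsubmxK => /cmrow_dsum[h1 h2].
have /eqP : z *m P = 0.
  rewrite -[z *m P]hsubmxK (cmrow_stdJ_prime pp pq _ h1); last by rewrite ltn_eqF.
  by rewrite (hN q pq Nq _ h2) row_mx0.
by rewrite mulmx_free_eq0 ?(mulmx1_free PQ) // => /eqP.
Qed.

(** The size [m] is kept apart from [g.*2] so that block sizes such as [k + k + c] fit without
    casts. *)
Definition abelian_rho (g r : nat) := exists m (J : 'M[R]_m),
  [/\ m = g.*2, cplx J, polarized J & rho J = r].

Lemma abelian_rho_le g r : abelian_rho g r -> (r <= g ^ 2)%N.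
Proof.
move=> [m [J [mg JJ pJ <-]]]; have := rho_le_sqr JJ pJ; nia.
Qed.

Lemma abelian_rho_gt0 g r : (0 < g)%N -> abelian_rho g r -> (0 < r)%N.
Proof.
move=> g0 [m [J [mg JJ [E [nE pE]] <-]]]; rewrite lt0n dimv_eq0; apply/eqP => h.
have /nsvP : nsform J E by [].
rewrite h memv0 => /eqP E0; have m0 : (0 < m)%N by rewrite mg double_gt0.
have [u u0] := ex_row_neq0 m0; have := pE (rmx u).
by rewrite map_mx_eq0 => /(_ u0); rewrite E0 map_mx0 mulmx0 mul0mx mxE ltxx.
Qed.

Lemma abelian_rho0 r : abelian_rho 0 r <-> r = 0%N.
Proof.
split=> [/abelian_rho_le|->]; first by case: r.
exists 0%N, 0; split=> //; last exact: rho_dim0.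
  by apply/matrixP=> -[].
exists 0; split; first exact: nsform0.
by move=> s; rewrite [s]thinmx0 eqxx.
Qed.

Lemma abelian_rho_add g n x : (n <= g)%N -> abelian_rho n x ->
  abelian_rho g ((g - n) ^ 2 + x)%N.
Proof.
move=> ng [m [J [mn JJ pJ <-]]]; have [N hN] := cm_primes_bounded JJ pJ.
have [p Np pp] := prime_above N.
have p0 : 0 < p%:R :> rat by rewrite ltr0n prime_gt0.
exists ((g - n) + (g - n) + m)%N, (dsum (stdJ R p%:R (g - n)) J); split.
- by rewrite mn addnn -doubleD subnK.
- by apply: cplx_dsum => //; apply: cplx_stdJ.
- by apply: polarized_dsum => //; apply: polarized_stdJ.
rewrite rho_dsum ?rho_stdJ ?mulnn //; apply: unrelated_stdJ => //.
by apply: hN; rewrite ?(ltnW Np).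
Qed.

(* By [rho_le_cm] a CM isotypic component has codimension [n < 4 l + 2]; then
   [r <= (g - n) ^ 2 + n ^ 2] forces [n <= l]. *)
Lemma abelian_rho_large l g r : (l + (4 * l + 2) ^ 2 <= g)%N ->
  abelian_rho g r -> ((g - l) ^ 2 + 1 <= r)%N ->
  exists n x, [/\ (n <= l)%N, abelian_rho n x & r = ((g - n) ^ 2 + x)%N].
Proof.
move=> lg [m [J [mg JJ pJ rE]]] lr.
(* [w] counts rational dimensions, so the cut is twice [g - 4 l - 2]. *)
have [[d [w [X [d0 Xf XP wD]]]]|noCM] := pselect (exists d w (X : 'M[rat]_(w, m)),
    [/\ 0 < d, row_free X, forall x : 'rV_m, (x <= X)%MS -> cmrow d J x &
       (2 * g - 8 * l - 4 < w)%N]); last first.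
  have h : (8 * rho J <= m * (m + (2 * g - 8 * l - 4) + 4))%N.
    apply: rho_le_cm => // d w X d0 Xf XP.
    by rewrite leqNgt; apply/negP => wD; apply: noCM; exists d, w, X.
  have gE : g = ((g - (4 * l + 2)) + (4 * l + 2))%N by rewrite subnK //; nia.
  move: h lr; rewrite rE mg gE; move: (g - _)%N => g' h.
  have -> : (g' + (4 * l + 2) - l = g' + 3 * l + 2)%N by lia.
  move: h; have -> : (2 * (g' + (4 * l + 2)) - 8 * l - 4 = 2 * g')%N by lia.
  nia.
have [k [Y [c [_ [J2 [[YP Yf] [cJ2 pJ2 _ _] _ /isog_dim mE rhoE]]]]]] := cm_split d0 JJ pJ.
have wk : (w <= k + k)%N.
  rewrite -(eqP Xf) -(eqP Yf); apply: mxrankS; apply/row_subP=> i.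
  by apply/YP/XP; rewrite row_sub.
pose n := (g - k)%N; have cE : c = n.*2 by rewrite /n; lia.
have nl : (n < 4 * l + 2)%N by rewrite /n; lia.
have gk : (g - n)%N = k by rewrite /n; lia.
have r2 : (rho J2 <= n ^ 2)%N.
  have := rho_le_sqr cJ2 pJ2; move: (rho J2) => rJ2.
  by rewrite cE -mul2n expnMn leq_pmul2l.
exists n, (rho J2); split; last by rewrite -rE rhoE gk mulnn.
  rewrite leqNgt; apply/negP => ln.
  move: lr; rewrite -rE rhoE mulnn.
  have : (k ^ 2 <= (g - l - 1) ^ 2)%N by rewrite leq_sqr -gk -subnDA addn1 leq_sub2l.
  have : (n ^ 2 <= (4 * l + 1) ^ 2)%N by rewrite leq_sqr -ltnS -addnS.
  have : ((4 * l + 1) ^ 2 < (4 * l + 2) ^ 2)%N by rewrite ltn_sqr ltn_add2l.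
  have : ((4 * l + 2) ^ 2 <= g - l)%N by rewrite leq_subRL ?(leq_trans (leq_addr _ _) lg).
  have : (g - l = (g - l - 1) + 1)%N.
    rewrite subnK // subn_gt0; apply: leq_trans lg.
    by rewrite -{1}[l]addn0 ltn_add2l expn_gt0 addn2.
  move: (g - l - 1)%N r2 => a r2 ->; rewrite (sqrnD a 1); clear -r2.
  move: (rho J2) ((4 * l + 2) ^ 2)%N ((4 * l + 1) ^ 2)%N (k ^ 2)%N (n ^ 2)%N (a ^ 2)%N r2.
  by lia.
by exists c, J2; split.
Qed.

End Realizable.

(** * Complex tori and complex structures *)

Section Torus.
Variable R : realType.
Notation cmx A := (map_mx (fun x : R => x%:C) A).

Definition rotation g : 'M[R]_(g + g) := block_mx 0 1%:M (- 1%:M) 0.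

Definition to_complex g (z : 'rV[R]_(g + g)) : 'rV[R[i]]_g :=
  \row_j (lsubmx z 0 j +i* rsubmx z 0 j).

Lemma to_complex_inj g : injective (@to_complex g).
Proof.
move=> x y xy; rewrite -[x]hsubmxK -[y]hsubmxK.
have h j : lsubmx x 0 j = lsubmx y 0 j /\ rsubmx x 0 j = rsubmx y 0 j.
  by move/rowP: xy => /(_ j); rewrite !mxE => -[-> ->].
by congr row_mx; apply/rowP=> j; case: (h j).
Qed.

Lemma rotationE g (z : 'rV[R]_(g + g)) : z *m rotation g = row_mx (- rsubmx z) (lsubmx z).
Proof.
rewrite -{1}[z]hsubmxK /rotation mul_row_block !mulmx0 addr0 add0r mulmx1.
by rewrite mulmxN mulmx1.
Qed.

Lemma to_complexJ g (z : 'rV[R]_(g + g)) :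
  to_complex (z *m rotation g) = 'i%C *: to_complex z.
Proof.
rewrite rotationE; apply/rowP=> j; rewrite [LHS]mxE row_mxKl row_mxKr !mxE.
by simpc.
Qed.

Lemma complex_sum (I : finType) (a b : I -> R) :
  \sum_k (a k +i* b k) = (\sum_k a k) +i* (\sum_k b k).
Proof.
elim/big_rec3: _ => // k z x y _ ->; by simpc.
Qed.

Lemma to_complex_mul g n (M : 'M[R]_(n, g + g)) (P : 'M[R[i]]_(n, g)) (s : 'rV[R]_n) :
  (forall i j, P i j = lsubmx M i j +i* rsubmx M i j) ->
  cmx s *m P = to_complex (s *m M).
Proof.
move=> hP; apply/rowP=> j; rewrite !mxE -complex_sum; apply: eq_bigr => k _.
by rewrite !mxE hP !mxE; simpc.
Qed.

(** Freeness of the periods makes their real coordinate matrix [M] invertible; [J] is multiplication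
    by [i] conjugated by it. *)
Lemma torus_complex_structure g (A : complexTorus R g) : exists J : 'M[R]_(g.*2),
  cplx J /\ forall s, real_point A (s *m J) = 'i%C *: real_point A s.
Proof.
pose M : 'M[R]_(g.*2, g + g) :=
  row_mx (\matrix_(i, j) complex.Re (periods A i j)) (\matrix_(i, j) complex.Im (periods A i j)).
have pE s : real_point A s = to_complex (s *m M).
  apply: to_complex_mul => i j; rewrite /M row_mxKl row_mxKr !mxE.
  by case: (periods A i j).
have Mf : row_free M.
  rewrite -kermx_eq0; apply/rowV0P=> s /sub_kermxP sM.
  apply: (@periods_free _ _ A); rewrite -[LHS]/(real_point A s) pE sM.
  by apply/rowP=> j; rewrite !mxE.
have Mfull : row_full M by rewrite /row_full (eqP Mf) addnn.
have [Q [MQ QM]] := free_full_inv Mf Mfull.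
exists (M *m rotation g *m Q); split.
  rewrite /cplx !mulmxA -(mulmxA (M *m _)) QM mulmx1 -(mulmxA M).
  have -> : rotation g *m rotation g = - 1%:M.
    rewrite /rotation mulmx_block !mul0mx !mulmx0 !add0r !addr0 mul1mx mulmx1.
    by rewrite scalar_mx_block opp_block_mx !oppr0.
  by rewrite mulmxN mulNmx mulmx1 MQ.
by move=> s; rewrite !pE -!mulmxA QM mulmx1 mulmxA to_complexJ.
Qed.

(** Over the reals, [quadratic_basis] with [d = 1] is a complex basis for the structure [J]; the
    coordinates of the lattice basis in it serve as periods. *)
Lemma complex_structure_torus g (J : 'M[R]_(g.*2)) : cplx J ->
  exists A : complexTorus R g, forall s, real_point A (s *m J) = 'i%C *: real_point A s.
Proof.
move=> JJ.
have [||k [Z [Q [NQ QN]]]] := @quadratic_basis _ 1 _ J.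
- move=> a b /eqP; rewrite mul1r paddr_eq0 ?sqr_ge0 // !sqrf_eq0.
  by case/andP=> /eqP-> /eqP->.
- exact: JJ.
have kg : k = g by have := rat_inv_dim NQ QN; lia.
subst k; set N := col_mx _ _ in NQ QN.
have JN : N *m J = rotation g *m N.
  rewrite /N /rotation mul_col_mx mul_block_col !mul0mx add0r addr0 mul1mx -mulmxA JJ.
  by rewrite mulmxN mulmx1 mulNmx mul1mx.
have JQ : J *m Q = Q *m rotation g.
  by rewrite -[LHS]mul1mx -QN -!mulmxA (mulmxA N) JN -!mulmxA NQ mulmx1.
pose P : 'M[R[i]]_(g.*2, g) := \matrix_(i, j) (lsubmx Q i j +i* rsubmx Q i j).
have PE s : cmx s *m P = to_complex (s *m Q).
  by apply: to_complex_mul => i j; rewrite mxE.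
have Pf (s : 'rV[R]_(g.*2)) : cmx s *m P = 0 -> s = 0.
  rewrite PE => h; have : s *m Q = 0.
    by apply: to_complex_inj; rewrite h; apply/rowP=> j; rewrite !mxE.
  by move/(congr1 (mulmxr N)); rewrite /= mul0mx -mulmxA QN mulmx1.
exists (ComplexTorus Pf) => s.
by rewrite /real_point /= !PE -mulmxA JQ mulmxA to_complexJ.
Qed.

Section WithStructure.
Variables (g : nat) (A : complexTorus R g) (J : 'M[R]_(g.*2)).
Hypothesis JA : forall s, real_point A (s *m J) = 'i%C *: real_point A s.
Hypothesis JJ : cplx J.

Lemma real_point_inj : injective (real_point A).
Proof.
move=> s t st; apply/eqP; rewrite -subr_eq0; apply/eqP/(@periods_free _ _ A).
rewrite (_ : map_mx _ (s - t) = cmx s - cmx t); last by rewrite map_mxB.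
by rewrite mulmxBl; apply/eqP; rewrite subr_eq0; apply/eqP.
Qed.

Lemma map_intr_ratr m n (E : 'M[int]_(m, n)) :
  map_mx (ratr : rat -> R) (map_mx intr E) = map_mx intr E.
Proof. by apply/matrixP=> i j; rewrite !mxE ratr_int. Qed.

Lemma positive_definite_posform E :
  positive_definite A E <-> posform J (map_mx intr E).
Proof.
rewrite /posform map_intr_ratr; split=> [h s s0|h s t ts s0].
  by apply: h s0; apply: JA.
by rewrite -JA in ts; rewrite (real_point_inj ts); apply: h.
Qed.

End WithStructure.

(** * Ranks of groups of integral forms *)

Lemma clear_denominators (I : finType) (q : I -> rat) :
  exists (N : int) (c : I -> int), 0 < N /\ forall i, N%:~R * q i = (c i)%:~R.
Proof.
exists (\prod_i denq (q i)), (fun i => numq (q i) * \prod_(j | j != i) denq (q j)).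
split; first by apply: prodr_gt0 => i _; apply: denq_gt0.
move=> i; rewrite (bigD1 i) //= -[X in _ * X = _]divq_num_den !intrM.
by field; rewrite intr_eq0 denq_neq0.
Qed.

Lemma clear_matrix_denominators m n (q : 'M[rat]_(m, n)) :
  exists (N : int) (c : 'M[int]_(m, n)), 0 < N /\ N%:~R *: q = map_mx intr c.
Proof.
have [N [c [N0 h]]] := clear_denominators (fun ij : 'I_m * 'I_n => q ij.1 ij.2).
exists N, (\matrix_(i, j) c (i, j)); split=> //.
by apply/matrixP=> i j; rewrite !mxE -h.
Qed.

Lemma intr_sum_mx (m n k : nat) (v : 'I_k -> 'M[int]_(m, n)) (c : 'I_k -> int) :
  map_mx intr (\sum_i v i *~ c i) = \sum_i (c i)%:~R *: (map_mx intr (v i) : 'M[rat]_(m, n)).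
Proof.
rewrite raddf_sum; apply: eq_bigr => i _; apply/matrixP=> a b.
by rewrite -scaler_int !mxE /= intrM intz.
Qed.

Lemma map_intr_inj m n : injective (fun E : 'M[int]_(m, n) => map_mx intr E : 'M[rat]_(m, n)).
Proof.
by move=> A B /matrixP h; apply/matrixP=> i j; have := h i j; rewrite !mxE => /intr_inj.
Qed.

(** [S] lies between the integral invariant forms and their doubles, and both of these have the
    rational dimension as rank. *)
Lemma integral_forms_rank m (J : 'M[R]_m) (S : set 'M[int]_m) :
  (forall E, S E -> nsform J (map_mx intr E)) ->
  (forall E, nsform J (map_mx intr E) -> S (E *+ 2)) ->
  has_rank S (rho J).
Proof.
move=> S1 S2; split.
  pose b := vbasis (nsv J).
  have /choice[N hN] (i : 'I_(rho J)) : exists NE : int * 'M[int]_m,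
      0 < NE.1 /\ NE.1%:~R *: b`_i = map_mx intr NE.2.
    by have [N [E h]] := clear_matrix_denominators b`_i; exists (N, E).
  have bns i : nsform J b`_i.
    by apply/nsvP; case: (ltnP i (size b)) => hi; [apply: vbasis_mem; apply: mem_nth
      | rewrite nth_default // mem0v].
  exists (fun i => (N i).2 *+ 2); split=> [i|c hc i].
    apply: S2; rewrite -(hN i).2 -[_ *: _]addr0; apply: nsformD (bns i) _.
    exact: nsform0.
  have := congr1 (fun E : 'M[int]_m => map_mx intr E : 'M[rat]_m) hc.
  rewrite intr_sum_mx map_mx0 => h0.
  have /freeP fb := basis_free (vbasisP (nsv J)).
  suff /fb/(_ i) /eqP : \sum_j ((c j)%:~R * 2 * (N j).1%:~R) *: b`_j = 0.
    by rewrite !mulf_eq0 !intr_eq0 (gt_eqF (hN i).1) pnatr_eq0 !orbF => /eqP.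
  rewrite -[RHS]h0; apply: eq_bigr => j _.
  by rewrite -!scalerA (hN j).2 raddfMn scaler_nat.
move=> n v vS vind.
pose w i := map_mx intr (v i) : 'M[rat]_m.
have wf : free [tuple w i | i < n].
  apply/freeP => k hk i; have [N [c [N0 hc]]] := clear_denominators k.
  have : c i = 0.
    apply: vind; apply: map_intr_inj; rewrite intr_sum_mx map_mx0.
    have := congr1 (fun X => N%:~R *: X) hk; rewrite scaler0 scaler_sumr => e; rewrite -[RHS]e; apply: eq_bigr => j _.
    by rewrite (nth_map j) ?size_enum_ord // nth_ord_enum scalerA hc.
  move=> ci; have /eqP := hc i; rewrite ci mulf_eq0 intr_eq0 (gt_eqF N0) /=.
  by move/eqP.
have := wf; rewrite /free size_tuple => /eqP <-; apply: dimvS; apply/span_subvP => x.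
by move=> /mapP[i _ ->]; apply/nsvP/S1.
Qed.

Lemma has_rank_unique (V : zmodType) (S : set V) r r' : has_rank S r -> has_rank S r' -> r = r'.
Proof.
move=> [[v [vS vi]] h] [[v' [vS' vi']] h']; apply/eqP.
by rewrite eqn_leq (h' _ v) // (h _ v').
Qed.

End Torus.

(** * The complex exponential *)

Lemma differentiable_approx (K : numFieldType) (V W : normedModType K) (f : V -> W) x :
  differentiable f x -> forall e, 0 < e -> exists2 d, 0 < d &
    forall h, `|h| < d -> `|f (x + h) - (f x + 'd f x h)| <= e * `|h|.
Proof.
move=> /diff_locally /eqaddoP h e e0.
have /nbhs_norm0P[d d0 hd] := h e e0; exists d => // k kd.
by rewrite [x + k]addrC; exact: hd k kd.
Qed.

Lemma differentiable_linear_approx (K : numFieldType) (V W : normedModType K) (f : V -> W) x :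
  differentiable f x -> exists df : {linear V -> W}, forall e, 0 < e -> exists2 d, 0 < d &
    forall h, `|h| < d -> `|f (x + h) - (f x + df h)| <= e * `|h|.
Proof. by move=> /differentiable_approx h; exists ('d f x). Qed.

Section Exponential.
Variable R : realType.

Lemma real_derive_approx (f : R -> R) (d : R) : is_derive (0 : R) 1 f d ->
  forall e, 0 < e -> exists2 del, 0 < del &
    forall h, `|h| < del -> `|f h - (f 0 + h * d)| <= e * `|h|.
Proof.
move=> [fd fE] e e0; have fdiff : differentiable f 0 by apply/derivable1_diffP.
have [del del0 hdel] := differentiable_approx fdiff e0; exists del => // h hh.
by have := hdel h hh; rewrite add0r deriv1E //= derive1E fE.
Qed.

Lemma normc_real (x : R) : `|x%:C : R[i]| = `|x|%:C.
Proof. by rewrite normc_def /= expr0n addr0 sqrtr_sqr. Qed.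

Lemma normc_le (z : R[i]) : `|z| <= (`|complex.Re z| + `|complex.Im z|)%:C.
Proof.
rewrite [z in `|z|]complexE (le_trans (ler_normD _ _)) // normrM !normc_real.
by rewrite [`|'i%C|]normc_def /= expr0n expr1n add0r sqrtr1 mul1r rmorphD.
Qed.

Lemma normc_ge_Im (z : R[i]) : `|complex.Im z|%:C <= `|z|.
Proof.
by rewrite normc_def lecR -sqrtr_sqr ler_wsqrtr // lerDr sqr_ge0.
Qed.

Lemma cexpD (z w : R[i]) : cexp (z + w) = cexp z * cexp w.
Proof.
case: z w => [a b] [c d]; simpc; rewrite /= expRD cosD sinD; simpc.
by congr (_ +i* _); ring.
Qed.

Lemma cexp0 : cexp (0 : R[i]) = 1.
Proof. by rewrite /cexp /= expR0 cos0 sin0 mulr1 mulr0. Qed.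

Lemma cexp_neq0 (z : R[i]) : cexp z != 0.
Proof.
apply/eqP => h; have := cexpD z (- z); rewrite subrr cexp0 h mul0r.
by move/eqP; rewrite oner_eq0.
Qed.

Lemma cexp_int (n : int) : cexp ((pi *+ 2)%:C * 'i%C * n%:~R : R[i]) = 1.
Proof.
have nat_case (k : nat) : cexp ((pi *+ 2)%:C * 'i%C * k%:R : R[i]) = 1.
  elim: k => [|k IH]; first by rewrite mulr0 cexp0.
  rewrite -natr1 mulrDr cexpD IH mul1r mulr1; simpc; rewrite /cexp.
  by rewrite expR0 cos2pi sin2pi mulr1 mulr0.
case: n => k; first exact: nat_case.
have := cexpD ((pi *+ 2)%:C * 'i%C * k.+1%:R) ((pi *+ 2)%:C * 'i%C * (Negz k)%:~R : R[i]).
by rewrite nat_case mul1r -mulrDr NegzE rmorphN /= subrr mulr0 cexp0.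
Qed.


Lemma cexp_approx0 (e : R) : 0 < e -> exists2 d, 0 < d &
  forall h : R[i], `|h| < d%:C -> `|cexp h - 1 - h| <= e%:C * `|h|.
Proof.
(* The errors below add up to at most [5 e1 |x| + 3 e1 |y|], hence the tenth of [e]; [e1 <= 1]
   allows crude bounds such as [|1 + x| <= 2]. *)
move=> e0; have [e1 [e1_0 e1_1 e1_e]] : exists e1 : R, [/\ 0 < e1, e1 <= 1 & e1 <= e / 10].
  exists (Num.min 1 (e / 10)); split; first by rewrite lt_min ltr01 divr_gt0.
    by rewrite ge_min lexx.
  by rewrite ge_min lexx orbT.
have [d1 d1_0 h1] := real_derive_approx (is_derive_expR (0 : R)) e1_0.
have [d2 d2_0 h2] := real_derive_approx (is_derive_cos (0 : R)) e1_0.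
have [d3 d3_0 h3] := real_derive_approx (is_derive_sin (0 : R)) e1_0.
exists (Num.min (Num.min d1 d2) (Num.min d3 e1)); first by rewrite !lt_min d1_0 d2_0 d3_0 e1_0.
case=> x y hd.
have hx : `|x| < Num.min (Num.min d1 d2) (Num.min d3 e1).
  by rewrite -ltcR; apply: le_lt_trans hd; apply: (normc_ge_Re (x +i* y)).
have hy : `|y| < Num.min (Num.min d1 d2) (Num.min d3 e1).
  by rewrite -ltcR; apply: le_lt_trans hd; apply: (normc_ge_Im (x +i* y)).
move: hx hy; rewrite !lt_min => /andP[/andP[x1 _] /andP[_ x4]] /andP[/andP[_ y2] /andP[y3 y4]].
have := h1 x x1; have := h2 y y2; have := h3 y y3.
rewrite expR0 cos0 sin0 oppr0 mulr0 !mulr1 addr0 add0r => es ec ex.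
apply: le_trans (_ : (e / 2 * `|x| + e / 2 * `|y|)%:C <= _); last first.
  have := normc_ge_Re (x +i* y); have := normc_ge_Im (x +i* y) => /= b1 b2.
  rewrite rmorphD [X in X + _]rmorphM [X in _ + X]rmorphM /=.
  have -> : e%:C * `|x +i* y| = (e / 2)%:C * `|x +i* y| + (e / 2)%:C * `|x +i* y|.
    by rewrite -mulrDl -rmorphD /= -splitr.
  by apply: lerD; apply: ler_wpM2l => //; rewrite ler0c divr_ge0 // ltW.
apply: le_trans (normc_le _) _; rewrite lecR /cexp; simpc => /=.
have x0 := normr_ge0 x; have y0 := normr_ge0 y.
have xle : `|expR x - 1| <= 2 * `|x|.
  have -> : expR x - 1 = (expR x - (1 + x)) + x by ring.
  by apply: le_trans (ler_normD _ _) _; nra.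
have yle : `|sin y| <= 2 * `|y|.
  have -> : sin y = (sin y - y) + y by ring.
  by apply: le_trans (ler_normD _ _) _; nra.
have cb : `|cos y| <= 1 by apply/ler_normlP; rewrite lerNl cos_geN1 cos_le1.
have re : `|expR x * cos y - 1 - x| <= e1 * `|x| + 2 * (e1 * `|y|).
  have -> : expR x * cos y - 1 - x = (expR x - (1 + x)) * cos y + (1 + x) * (cos y - 1) by ring.
  apply: le_trans (ler_normD _ _) _; rewrite !normrM; apply: lerD.
    by rewrite -[leRHS]mulr1; apply: ler_pM.
  apply: ler_pM => //.
  by apply: le_trans (ler_normD _ _) _; rewrite normr1; lra.
have im : `|expR x * sin y - y| <= 4 * e1 * `|x| + e1 * `|y|.
  have -> : expR x * sin y - y = (expR x - 1) * sin y + (sin y - y) by ring.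
  apply: le_trans (ler_normD _ _) _; rewrite normrM; apply: lerD => //.
  apply: le_trans (_ : (2 * `|x|) * (2 * `|y|) <= _); first exact: ler_pM.
  by nra.
nra.
Qed.

Lemma cexp_differentiable (z : R[i]) : differentiable (@cexp R : R[i]^o -> R[i]^o) (z : R[i]^o).
Proof.
apply/derivable1_diffP; apply/cvg_ex; exists (cexp z : R[i]^o).
apply/cvgrPdist_le => e e0.
have : e = (complex.Re e)%:C by rewrite RRe_real // gtr0_real.
move: (complex.Re e) => r er; rewrite {}er in e0 *.
rewrite ltcR in e0.
have [c c0 hc] : exists2 c : R, 0 < c & `|cexp z| <= c%:C.
  exists (`|complex.Re (cexp z)| + `|complex.Im (cexp z)| + 1).
    by rewrite ltr_pwDr ?addr_ge0.
  by apply: le_trans (normc_le _) _; rewrite lecR lerDl ler01.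
have [d d0 hd] := cexp_approx0 (divr_gt0 e0 c0).
near=> h.
have h0 : h != 0 by near: h; exact: nbhs_dnbhs_neq.
rewrite /= [h *: 1]mulr1 cexpD.
have -> : cexp z - h^-1 *: (cexp h * cexp z - cexp z) =
    - (cexp z * ((cexp h - 1 - h) / h)) :> R[i].
  by rewrite [_ *: _]mulrC; field.
rewrite normrN normrM normf_div; apply: le_trans (_ : c%:C * (r / c)%:C <= _).
  apply: ler_pM => //; rewrite ?divr_ge0 // ler_pdivrMr ?normr_gt0 //; apply: hd.
  near: h; apply: dnbhs0_lt; by rewrite ltcR.
by rewrite -rmorphM mulrCA divff ?mulr1 // gt_eqF.
Unshelve. all: by end_near. Qed.

End Exponential.

(** * Line bundles from invariant forms *)

Lemma kernel_factor (F : fieldType) n p q (A : 'M[F]_(n, p)) (B : 'M[F]_(n, q)) :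
  (forall z : 'rV_n, z *m A = 0 -> z *m B = 0) -> exists L, A *m L = B.
Proof.
move=> AB; exists (pinvmx A *m B).
have : (1%:M - A *m pinvmx A) *m B = 0.
  apply/row_matrixP=> i; rewrite row_mul row0; apply: AB.
  by rewrite -row_mul mulmxBl mul1mx mulmxKpV // subrr row0.
by move/eqP; rewrite mulmxBl mul1mx subr_eq0 mulmxA => /eqP.
Qed.

Section LineBundle.
Variables (R : realType) (g : nat) (A : complexTorus R g) (J : 'M[R]_(g.*2)).
Hypothesis JA : forall s, real_point A (s *m J) = 'i%C *: real_point A s.
Hypothesis JJ : cplx J.
Notation C := R[i].
Notation cmx A := (map_mx (real_complex R) A).

Lemma real_part_split n (z : 'rV[C]_n) :
  z = cmx (map_mx (@complex.Re R) z) + 'i%C *: cmx (map_mx (@complex.Im R) z).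
Proof. by apply/rowP=> j; rewrite !mxE -complexE. Qed.

Lemma real_pointD s t : real_point A (s + t) = real_point A s + real_point A t.
Proof. by rewrite /real_point (map_mxD (real_complex R)) mulmxDl. Qed.

Lemma lattice_pointD m n :
  lattice_point A (m + n) = lattice_point A m + lattice_point A n.
Proof. by rewrite /lattice_point map_mxD mulmxDl. Qed.

Lemma real_pointN s : real_point A (- s) = - real_point A s.
Proof. by rewrite /real_point (map_mxN (real_complex R)) mulNmx. Qed.

(** Such [z] satisfy [z J = - i z]: the kernel of the complexified period map consists of the
    antiholomorphic directions. *)
Lemma periods_kernel (z : 'rV[C]_(g.*2)) : z *m periods A = 0 ->
  exists b : 'rV[R]_(g.*2), z = - cmx (b *m J) + 'i%C *: cmx b.
Proof.
rewrite [z]real_part_split; set a := map_mx _ z; set b := map_mx _ z => h.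
exists b; congr (_ + _); rewrite -map_mxN; congr (cmx _).
apply: (@real_point_inj _ _ A); apply/eqP; rewrite -subr_eq0.
by rewrite real_pointN opprK JA -h mulmxDl scalemxAl.
Qed.

Variable E : 'M[int]_(g.*2).
Hypothesis nE : nsform J (map_mx intr E).

Lemma nsform_int_anti : J *m map_mx intr E = - (map_mx intr E *m J^T) :> 'M[R]_(g.*2).
Proof. by have := nsform_anti JJ nE; rewrite map_intr_ratr. Qed.

(* [B] is the matrix of the Hermitian form [H] of [E] in real coordinates. *)
Let B : 'M[C]_(g.*2) := cmx (J *m map_mx intr E) + 'i%C *: cmx (map_mx intr E).

(** [H] is complex linear in its first argument, so [B] vanishes on the kernel of the periods and
    factors through [V]. *)
Lemma hermitian_matrix : exists L : 'M[C]_(g, g.*2), periods A *m L = B.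
Proof.
apply: kernel_factor => z /periods_kernel[b ->].
rewrite /B mulmxDl !mulmxDr !mulNmx -!scalemxAl -!scalemxAr -!map_mxM scalerA.
rewrite [b *m J *m (J *m _)]mulmxA -(mulmxA b) JJ mulmxN mulmx1 mulNmx mulmxA.
rewrite map_mxN opprK -expr2 sqr_i scaleN1r.
move: (cmx (b *m _)) (_ *: _) => p q.
by rewrite addrA subrK subrr.
Qed.

Let hform (m n : 'rV[int]_(g.*2)) : C := (map_mx intr m *m B *m (map_mx intr n)^T) 0 0.

Lemma intr_cmx p q (M : 'M[int]_(p, q)) : map_mx intr M = cmx (map_mx intr M).
Proof. by apply/matrixP=> i j; rewrite !mxE rmorph_int. Qed.

Lemma alt_form_real m n : (alt_form E m n)%:~R =
  (map_mx intr m *m map_mx intr E *m (map_mx intr n)^T) 0 0 :> R.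
Proof.
by rewrite map_trmx -!map_mxM mxE.
Qed.

(** The real part [E (i x, y)] of [H] is symmetric, so only the imaginary part survives. *)
Lemma hform_antisym m n : hform m n - hform n m = 2 * 'i%C * (alt_form E m n)%:~R.
Proof.
pose F (m n : 'rV[int]_(g.*2)) : R := (map_mx intr m *m (J *m map_mx intr E) *m (map_mx intr n)^T) 0 0.
have hF m' n' : hform m' n' = (F m' n')%:C + 'i%C * (alt_form E m' n')%:~R.
  rewrite -(rmorph_int (real_complex R)) alt_form_real /hform /B /F mulmxDr mulmxDl mxE.
  rewrite -scalemxAr -scalemxAl [X in _ + X]mxE !intr_cmx !map_trmx -!map_mxM.
  by rewrite !mxE.
have Fsym : F m n = F n m.
  rewrite /F -[in RHS](trmxK (_ *m _ *m _)) [RHS]mxE !trmx_mul trmxK nsform_int_anti.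
  have tE : (map_mx intr E : 'M[R]_(g.*2))^T = - map_mx intr E.
    by rewrite -(map_intr_ratr R E) map_trmx nE.1 map_mxN.
  by rewrite tE !(mulNmx, mulmxN) !mulmxA.
have Esym : alt_form E n m = - alt_form E m n.
  have tE : E^T = - E.
    by apply: map_intr_inj; rewrite -map_trmx nE.1 map_mxN.
  have -> : alt_form E n m = (n *m E *m m^T)^T 0 0 by rewrite mxE.
  by rewrite !trmx_mul trmxK tE mulNmx mulmxN mulmxA /alt_form [LHS]mxE.
by rewrite !hF Fsym Esym rmorphN /=; ring.
Qed.

(* The Appell-Humbert factor [exp (pi H' (v, m) + pi / 2 H' (m, m))] of [H' = 2 H],
   for which the trivial semicharacter is allowed. *)
Lemma nsform_neron_severi : neron_severi A (E *+ 2).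
Proof.
have [L LB] := hermitian_matrix.
pose H (m : 'rV[int]_(g.*2)) (v : 'rV[C]_g) : C := (v *m (L *m (map_mx intr m)^T)) 0 0.
have HD m (v w : 'rV[C]_g) : H m (v + w) = H m v + H m w by rewrite /H mulmxDl mxE.
have HDm m n (v : 'rV[C]_g) : H (m + n) v = H m v + H n v.
  by rewrite /H map_mxD linearD /= !mulmxDr mxE.
have Hl m n : H m (lattice_point A n) = hform n m.
  by rewrite /H /lattice_point /hform -LB !mulmxA.
pose f (m : 'rV[int]_(g.*2)) (v : 'rV[C]_g) : C^o := - 'i%C * (H m v + H m (lattice_point A m) / 2).
have Hdiff m : holomorphic (H m : _ -> C^o).
  move=> v; set c := L *m (map_mx intr m)^T.
  rewrite (_ : H m = \sum_k (fun w : 'rV[C]_g => (w 0 k : C^o)) * cst (c k 0)); last first.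
    by apply/funext => w; rewrite /H mxE fct_sumE.
  apply: differentiable_sum => k; apply: differentiableM => //.
  exact: differentiable_coord.
have fhol m : holomorphic (f m).
  move=> v; rewrite (_ : f m = cst (- 'i%C : C^o) *
      ((H m : _ -> C^o) + cst (H m (lattice_point A m) / 2 : C^o))); last first.
    by apply/funext=> w; rewrite mulrfctE addrfctE.
  apply: differentiableM; first exact: differentiable_cst.
  by apply: differentiableD; [apply: Hdiff | apply: differentiable_cst].
have i2 : 'i%C * 'i%C = -1 :> C by rewrite -expr2 sqr_i.
(* The defect is an integer, so it disappears under the exponential; with [H] in place of [2 H] it
   would be half of [E (m, n)]. *)
have cocycle m n v : f (m + n) v = f m (lattice_point A n + v) + f n v + (alt_form E m n)%:~R.
  rewrite /f !HD !HDm lattice_pointD !HD !Hl.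
  have -> : hform m n = hform n m + 2 * 'i%C * (alt_form E m n)%:~R.
    by rewrite -hform_antisym addrC subrK.
  move: (hform n m) (alt_form E m n)%:~R (H n v) (H m v) (hform n n) (hform m m) => a b c d p q.
  by field: i2.
exists (fun m v => cexp ((pi *+ 2)%:C * 'i%C * f m v)); split; last first.
  exists f; split=> // m n v; rewrite /f !HD !Hl.
  have -> : alt_form (E *+ 2) m n = 2 * alt_form E m n.
    by rewrite /alt_form mulr2n mulmxDr mulmxDl mxE mulr_natl mulr2n.
  rewrite intrM -[2%:~R]/(2 : C).
  have -> : hform m n = hform n m + 2 * 'i%C * (alt_form E m n)%:~R.
    by rewrite -hform_antisym addrC subrK.
  rewrite mulr_natl [in LHS]mulr2n.
  move: (hform n m) (alt_form E m n)%:~R (H n v) (H m v) (hform n n) (hform m m) => a b c d p q.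
  by field: i2.
split.
- move=> m v; apply: (@differentiable_comp _ _ _ _
      (fun v => (pi *+ 2)%:C * 'i%C * f m v : C^o) (@cexp R : C^o -> C^o)).
    rewrite (_ : (fun v => _) = cst ((pi *+ 2)%:C * 'i%C : C^o) * f m); last first.
      by apply/funext=> w; rewrite mulrfctE.
    by apply: differentiableM; [apply: differentiable_cst | apply: fhol].
  exact: cexp_differentiable.
- by move=> m v; apply: cexp_neq0.
move=> m n v; rewrite cocycle mulrDr mulrDr !cexpD.
by rewrite cexp_int mulr1.
Qed.

End LineBundle.

(** * Grid means and Goursat bisection *)

Section Averages.
Variables (R : realType) (n : nat).
Notation C := R[i].
Notation V := 'rV[R]_n.
Implicit Types (f g : V -> C) (x v : V) (k l : 'I_n) (h : R) (N : nat) (s : seq 'I_n).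

Definition unitv k : V := delta_mx 0 k.

Definition line_mean N h k f x : C :=
  N%:R^-1 * \sum_(i < N) f (x + (i%:R * h) *: unitv k).

(** Means over grids stand in for integrals over cubes of side [N h]: difference quotients telescope
    exactly on them, without any integrability condition. *)
Definition grid_mean N h s f : V -> C := foldr (line_mean N h) f s.

Definition diff_quot h k f x : C := (f (x + h *: unitv k) - f x) / h%:C.

Definition shift_by v f : V -> C := fun x => f (x + v).

Lemma line_mean_shift N h k v f :
  line_mean N h k (shift_by v f) = shift_by v (line_mean N h k f).
Proof.
apply/funext => x; rewrite /line_mean /shift_by; congr (_ * _).
by apply: eq_bigr => i _; rewrite addrAC.
Qed.

Lemma grid_mean_shift N h s v f :
  grid_mean N h s (shift_by v f) = shift_by v (grid_mean N h s f).
Proof. by elim: s => //= l s ->; rewrite line_mean_shift. Qed.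

Lemma line_mean_lin N h k (a b : C) f g :
  line_mean N h k (fun x => a * f x + b * g x) =
  fun x => a * line_mean N h k f x + b * line_mean N h k g x.
Proof.
apply/funext => x; rewrite /line_mean big_split /= -!mulr_sumr mulrDr.
by rewrite mulrCA [_ * (b * _)]mulrCA.
Qed.

Lemma grid_mean_lin N h s (a b : C) f g :
  grid_mean N h s (fun x => a * f x + b * g x) =
  fun x => a * grid_mean N h s f x + b * grid_mean N h s g x.
Proof. by elim: s => //= l s ->; rewrite line_mean_lin. Qed.

Lemma grid_mean0 N h s : grid_mean N h s (fun=> 0) = fun=> 0.
Proof.
by have := @grid_mean_lin N h s 0 0 (fun=> 0) (fun=> 0); under eq_fun do rewrite !mul0r addr0;
  move=> ->; apply/funext=> x; rewrite !mul0r addr0.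
Qed.

Lemma grid_mean_sum N h s (I : Type) (r : seq I) (d : I -> C) (F : I -> V -> C) x :
  grid_mean N h s (fun x => \sum_(i <- r) d i * F i x) x =
  \sum_(i <- r) d i * grid_mean N h s (F i) x.
Proof.
elim: r => [|i r IH].
  rewrite big_nil -[RHS]/((fun=> 0) x) -(grid_mean0 N h s).
  by congr (grid_mean _ _ _ _ _); apply/funext=> y; rewrite big_nil.
rewrite big_cons -IH -[X in _ + X]mul1r.
transitivity (grid_mean N h s (fun y => d i * F i y + 1 * \sum_(i <- r) d i * F i y) x).
  by congr (grid_mean _ _ _ _ _); apply/funext=> y; rewrite big_cons mul1r.
by rewrite grid_mean_lin.
Qed.

Lemma grid_mean_cst N h s (c : C) : (0 < N)%N -> grid_mean N h s (fun=> c) = fun=> c.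
Proof.
move=> N0; elim: s => //= l s ->; apply/funext=> x; rewrite /line_mean sumr_const card_ord.
by rewrite -[c *+ N]mulr_natl mulKf // pnatr_eq0 -lt0n.
Qed.

Lemma diff_quotE h k f :
  diff_quot h k f = fun x => h%:C^-1 * shift_by (h *: unitv k) f x + (- h%:C^-1) * f x.
Proof. by apply/funext=> x; rewrite /diff_quot mulrBl mulNr /shift_by !(mulrC h%:C^-1). Qed.

Lemma grid_mean_diff N h s k f :
  grid_mean N h s (diff_quot h k f) = diff_quot h k (grid_mean N h s f).
Proof. by rewrite !diff_quotE grid_mean_lin grid_mean_shift. Qed.

Lemma line_mean_diff N h k f x : (0 < N)%N -> h != 0 ->
  line_mean N h k (diff_quot h k f) x =
  (f (x + (N%:R * h) *: unitv k) - f x) / (N%:R * h)%:C.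
Proof.
move=> N0 h0; rewrite /line_mean /diff_quot -mulr_suml.
have -> : \sum_(i < N) (f (x + (i%:R * h) *: unitv k + h *: unitv k) -
      f (x + (i%:R * h) *: unitv k)) = f (x + (N%:R * h) *: unitv k) - f x.
  rewrite -(big_mkord xpredT (fun i => f (x + (i%:R * h) *: unitv k + h *: unitv k) -
      f (x + (i%:R * h) *: unitv k))).
  rewrite (@telescope_sumr_eq _ 0 N (fun i => f (x + (i%:R * h) *: unitv k))) //.
    by rewrite mul0r scale0r addr0.
  by move=> i _; rewrite -addrA -scalerDl -natr1 mulrDl mul1r.
by rewrite rmorphM rmorph_nat invfM mulrCA.
Qed.

Definition close (r : R) (x y : V) := forall j, `|y 0 j - x 0 j| <= r.

Lemma close_trans r1 r2 x y z : close r1 x y -> close r2 y z -> close (r1 + r2) x z.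
Proof.
move=> h1 h2 j; rewrite (_ : _ - _ = (y 0 j - x 0 j) + (z 0 j - y 0 j)); last by ring.
by rewrite (le_trans (ler_normD _ _)) // lerD.
Qed.

Lemma close_refl r x : 0 <= r -> close r x x.
Proof. by move=> r0 j; rewrite subrr normr0. Qed.

Lemma close_step a r k x : `|a| <= r -> close r x (x + a *: unitv k).
Proof.
move=> ar j; rewrite !mxE addrAC subrr add0r normrM eqxx /=.
by case: (j == k); rewrite ?normr1 ?mulr1 // normr0 mulr0 (le_trans _ ar).
Qed.

Lemma line_mean_bound N h k f x (M : C) : (0 < N)%N ->
  (forall i : nat, (i < N)%N -> `|f (x + (i%:R * h) *: unitv k)| <= M) ->
  `|line_mean N h k f x| <= M.
Proof.
move=> N0 fM; have N0' : 0 < N%:R :> C by rewrite ltr0n.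
rewrite /line_mean normrM normfV normr_nat ler_pdivrMl //.
rewrite (le_trans (ler_norm_sum _ _ _)) // -[N in X in _ <= X]card_ord mulr_natl -sumr_const.
by apply: ler_sum => i _; apply: fM.
Qed.

Lemma grid_step N h (i : nat) r : 0 <= h -> N%:R * h = r -> (i < N)%N -> `|i%:R * h| <= r.
Proof.
move=> h0 <- iN; rewrite ger0_norm ?mulr_ge0 ?ler0n // ler_wpM2r // ler_nat.
exact: ltnW.
Qed.

Lemma grid_mean_bound N h s f x r (M : C) : (0 < N)%N -> 0 <= h -> N%:R * h = r ->
  (forall y, close ((size s)%:R * r) x y -> `|f y| <= M) ->
  `|grid_mean N h s f x| <= M.
Proof.
move=> N0 h0 hr; elim: s x => [|l s IH] x fM /=.
  by apply: fM; apply: close_refl; rewrite mul0r.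
apply: line_mean_bound => // i iN; apply: IH => y xy; apply: fM.
rewrite -natr1 mulrDl mul1r addrC; apply: close_trans xy.
by apply: close_step; apply: grid_step iN.
Qed.

(** Telescoping in direction [k] leaves a difference between two opposite faces, so the bound
    depends on the side [r] and not on the mesh [h]. *)
Lemma grid_mean_diff_bound N h s k f x r (M : C) : (0 < N)%N -> 0 < h -> N%:R * h = r ->
  k \in s -> (forall y, close ((size s)%:R * r) x y -> `|f y| <= M) ->
  `|grid_mean N h s (diff_quot h k f) x| <= 2 * M / r%:C.
Proof.
move=> N0 h0 hr; have r0 : 0 < r by rewrite -hr mulr_gt0 // ltr0n.
elim: s x => [|l s IH] x //; rewrite inE => kls fM /=.
have xy i : (i <= N)%N -> forall z, close ((size s)%:R * r) (x + (i%:R * h) *: unitv l) z ->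
    close ((size (l :: s))%:R * r) x z.
  move=> iN z zc; rewrite /= -natr1 mulrDl mul1r addrC; apply: close_trans zc.
  apply: close_step; rewrite -hr ger0_norm ?mulr_ge0 ?ler0n ?(ltW h0) //.
  by rewrite ler_wpM2r ?(ltW h0) // ler_nat.
have [kl|kl] := eqVneq k l.
  rewrite grid_mean_diff kl line_mean_diff ?gt_eqF // hr normrM normfV.
  rewrite [`|r%:C|]ger0_norm ?ler0c ?(ltW r0) //; apply: ler_wpM2r.
    by rewrite invr_ge0 ler0c ltW.
  rewrite (le_trans (ler_normB _ _)) // mulr_natl mulr2n; apply: lerD.
    apply: (grid_mean_bound N0 (ltW h0) hr) => y yc; apply: fM; apply: (xy N) => //.
    by rewrite hr.
  apply: (grid_mean_bound N0 (ltW h0) hr) => y yc; apply: fM; apply: (xy 0%N) => //.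
  by rewrite mul0r scale0r addr0.
apply: line_mean_bound => // i iN; apply: IH; first by rewrite (negPf kl) in kls.
by move=> y yc; apply: fM; apply: (xy i) => //; apply: ltnW.
Qed.

Definition half_mean (r : R) k f x : C := 2^-1 * f x + 2^-1 * f (x + r *: unitv k).

Lemma line_mean_double N h k f :
  line_mean (N + N) h k f = half_mean (N%:R * h) k (line_mean N h k f).
Proof.
apply/funext=> x; rewrite /half_mean /line_mean big_split_ord /= natrD.
have -> : (N%:R + N%:R : C)^-1 = 2^-1 * N%:R^-1.
  have -> : N%:R + N%:R = 2 * N%:R :> C by ring.
  by rewrite invfM.
rewrite mulrDr !mulrA; congr (_ * _ + _ * _); apply: eq_bigr => i _.
by rewrite -addrA -scalerDl natrD mulrDl.
Qed.

Lemma line_mean_half N h k r l f :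
  line_mean N h k (half_mean r l f) = half_mean r l (line_mean N h k f).
Proof.
rewrite -[LHS]/(line_mean N h k (fun x => 2^-1 * f x + 2^-1 * shift_by (r *: unitv l) f x)).
by rewrite line_mean_lin line_mean_shift.
Qed.

(** A grid with twice as many points per direction splits into translated grids on the half
    cubes. *)
Lemma grid_mean_double N h s f :
  grid_mean (N + N) h s f = foldr (half_mean (N%:R * h)) (grid_mean N h s f) s.
Proof.
elim: s => //= l s ->; rewrite line_mean_double; congr (half_mean _ _ _).
by move: (grid_mean N h s f) => phi; elim: s => //= k s <-; rewrite line_mean_half.
Qed.

Lemma half_mean_eventually s r (f : nat -> V -> C) x (e : C) : 0 <= r ->
  (forall y, close ((size s)%:R * r) x y ->
     exists p0, forall p, (p0 <= p)%N -> `|f p y| <= e) ->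
  exists p0, forall p, (p0 <= p)%N -> `|foldr (half_mean r) (f p) s x| <= e.
Proof.
move=> r0; elim: s x => [|l s IH] x good /=.
  by apply: good; apply: close_refl; rewrite mul0r.
have [p1 h1] : exists p0, forall p, (p0 <= p)%N -> `|foldr (half_mean r) (f p) s x| <= e.
  apply: IH => y xy; apply: good => j; apply: le_trans (xy j) _.
  by rewrite ler_wpM2r // ler_nat.
have [p2 h2] : exists p0, forall p, (p0 <= p)%N ->
    `|foldr (half_mean r) (f p) s (x + r *: unitv l)| <= e.
  apply: IH => y xy; apply: good; rewrite -natr1 mulrDl mul1r addrC.
  by apply: close_trans xy; apply: close_step; rewrite ger0_norm.
exists (maxn p1 p2) => p; rewrite geq_max => /andP[/h1 b1 /h2 b2].
rewrite /half_mean (le_trans (ler_normD _ _)) // !normrM.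
rewrite [`|2^-1|]ger0_norm ?invr_ge0 ?ler0n //.
have -> : e = 2^-1 * e + 2^-1 * e by field.
by apply: lerD; rewrite ler_wpM2l ?invr_ge0 ?ler0n.
Qed.

(** The integrand receives the mesh as an argument because it will be a difference quotient with
    that step. *)
Definition dyadic_mean (f : R -> V -> C) (r : R) (p : nat) : V -> C :=
  grid_mean (2 ^ p) (r / 2 ^+ p) (enum 'I_n) (f (r / 2 ^+ p)).

(* Nested bisection: if the means over the unit cube are not eventually small,
   neither are those over some sequence of shrinking cubes. *)
Lemma bisection (f : R -> V -> C) (e : C) :
  (forall z : V, exists2 del : R, 0 < del & forall r x, 0 < r -> r <= del ->
     close (n%:R * r) x z ->
     exists p0, forall p, (p0 <= p)%N -> `|dyadic_mean f r p x| <= e) ->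
  exists p0, forall p, (p0 <= p)%N -> `|dyadic_mean f 1 p 0| <= e.
Proof.
move=> loc; apply: contrapT => bad0.
pose bad r x := ~ exists p0, forall p, (p0 <= p)%N -> `|dyadic_mean f r p x| <= e.
have step r x : 0 < r -> bad r x -> exists y, close (n%:R * (r / 2)) x y /\ bad (r / 2) y.
  move=> r0 badx; apply: contrapT => nex; apply: badx.
  have [||p0 hp0] := @half_mean_eventually (enum 'I_n) (r / 2) (dyadic_mean f (r / 2)) x e.
  - by rewrite divr_ge0 // ltW.
  - move=> y; rewrite size_enum_ord => xy; apply: contrapT => bady.
    by apply: nex; exists y.
  exists p0.+1 => -[//|p] pp; have := hp0 p pp; rewrite /dyadic_mean.
  have hE : r / 2 / 2 ^+ p = r / 2 ^+ p.+1 by rewrite exprS invfM mulrA.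
  have rE : (2 ^ p)%:R * (r / 2 / 2 ^+ p) = r / 2.
    by rewrite natrX mulrC divfK // expf_neq0 // pnatr_eq0.
  by rewrite -{1}rE -grid_mean_double addnn -mul2n -expnS hE.
have /choice[nxt hnxt] (rx : R * V) : exists y, 0 < rx.1 -> bad rx.1 rx.2 ->
    close (n%:R * (rx.1 / 2)) rx.2 y /\ bad (rx.1 / 2) y.
  have [[r0 bx]|nb] := pselect (0 < rx.1 /\ bad rx.1 rx.2).
    by have [y hy] := step _ _ r0 bx; exists y.
  by exists 0 => r0 bx; case: nb.
pose seqx := fix sx (q : nat) : V := if q is q'.+1 then nxt (2^-1 ^+ q', sx q') else 0.
have rq0 q : 0 < 2^-1 ^+ q :> R by rewrite exprn_gt0 // invr_gt0.
have badq q : bad (2^-1 ^+ q) (seqx q).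
  elim: q => [|q IH]; first by rewrite expr0.
  by have [_] := hnxt (_, _) (rq0 q) IH; rewrite /= exprSr.
have closeq q : close (n%:R * 2^-1 ^+ q.+1) (seqx q) (seqx q.+1).
  by have [] := hnxt (_, _) (rq0 q) (badq q); rewrite /= exprSr.
(* The moves from stage [q] on sum to at most [n / 2 ^ q], so the intervals [[a j q, b j q]] are
   nested and have a common point, which becomes coordinate [j] of [z]. *)
pose a j q := seqx q 0 j - n%:R * 2^-1 ^+ q.
pose b j q := seqx q 0 j + n%:R * 2^-1 ^+ q.
have stepab j q : a j q <= a j q.+1 /\ b j q.+1 <= b j q.
  have := closeq q j; rewrite /a /b ler_norml exprS.
  by move: (2^-1 ^+ q) => t /andP[]; split; lra.
have amono j p q : (p <= q)%N -> a j p <= a j q.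
  move=> pq; rewrite -(subnKC pq); elim: (q - p)%N => [|k IH]; first by rewrite addn0.
  by rewrite addnS (le_trans IH) //; case: (stepab j (p + k)%N).
have bmono j p q : (p <= q)%N -> b j q <= b j p.
  move=> pq; rewrite -(subnKC pq); elim: (q - p)%N => [|k IH]; first by rewrite addn0.
  by rewrite addnS (le_trans _ IH) //; case: (stepab j (p + k)%N).
have ab j p q : a j p <= b j q.
  have abq (i : nat) : a j i <= b j i by rewrite /a /b lerD2l -subr_ge0 opprK addr_ge0 // mulr_ge0 // ltW.
  case: (leqP p q) => [pq|/ltnW qp]; first by rewrite (le_trans (amono j _ _ pq)).
  by rewrite (le_trans (abq p)) // (bmono j _ _ qp).
pose z : V := \row_j sup [set a j q | q in setT].
have zclose q : close (n%:R * 2^-1 ^+ q) (seqx q) z.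
  move=> j; rewrite mxE ler_distl; apply/andP; split.
    apply: ub_le_sup; last by exists q.
    by exists (b j 0%N) => _ [k _ <-]; apply: ab.
  apply: ge_sup; first by exists (a j 0%N), 0%N.
  by move=> _ [k _ <-]; apply: ab.
have [del del0 hdel] := loc z.
have [q hq] : exists q, 2^-1 ^+ q <= del.
  exists (Num.bound del^-1); have := upper_nthrootP (leqnn (Num.bound del^-1)).
  rewrite exprVn => /ltW le; rewrite -[leRHS]invrK lef_pV2 // posrE ?invr_gt0 //.
by apply: (badq q); apply: hdel (zclose q).
Qed.

Lemma close_sym r (x y : V) : close r x y -> close r y x.
Proof. by move=> h j; rewrite distrC. Qed.

Lemma close_le r1 r2 (x y : V) : r1 <= r2 -> close r1 x y -> close r2 x y.
Proof. by move=> le h j; apply: le_trans (h j) le. Qed.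

(** The affine part of [G] at [z] has flux 0 along [d]. The remainder is [o(r)] near a cube of side
    [r], and [grid_mean_diff_bound] divides it by [r] only. *)
Lemma goursat (G : V -> C) (d : 'I_n -> C) :
  (forall z, exists l : V -> C,
    [/\ forall x h k, l (x + h *: unitv k) = l x + h%:C * l (unitv k),
        \sum_k d k * l (unitv k) = 0 &
        forall e : R, 0 < e -> exists2 del : R, 0 < del & forall r y, 0 < r -> r <= del ->
          close r z y -> `|G y - G z - l (y - z)| <= (e * r)%:C]) ->
  forall e : R, 0 < e -> exists p0, forall p, (p0 <= p)%N ->
    `|dyadic_mean (fun h x => \sum_k d k * diff_quot h k G x) 1 p 0| <= e%:C.
Proof.
move=> diffG e e0; apply: bisection => z; have [l [lD l0 approx]] := diffG z.
pose M := complex.Re (\sum_k `|d k|).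
have ME : \sum_k `|d k| = M%:C by rewrite /M RRe_real // ger0_real // sumr_ge0.
have M0 : 0 <= M by rewrite -ler0c -ME sumr_ge0.
have n0 : 0 <= n%:R :> R by rewrite ler0n.
(* The remainder is estimated within [2 (n + 1) r] of [z], telescoping costs [2 / r], and the
   coefficients sum to [M]; [c] is the product of these losses, with [M + 1] to stay positive. *)
pose c := 4 * (n%:R + 1) * (M + 1).
have c0 : 0 < c by rewrite !mulr_gt0 // ltr_wpDl.
have [del del0 hdel] := approx _ (divr_gt0 e0 c0).
exists (del / (2 * (n%:R + 1))); first by rewrite divr_gt0 ?mulr_gt0 // ltr_wpDl.
move=> r x r0 rdel xz; exists 0%N => p _.
pose rem y := G y - G z - l (y - z).
set h := r / 2 ^+ p; have h0 : 0 < h by rewrite divr_gt0 // exprn_gt0.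
have N0 : (0 < 2 ^ p)%N by rewrite expn_gt0.
have Nh : (2 ^ p)%:R * h = r by rewrite /h natrX mulrC divfK // expf_neq0 // pnatr_eq0.
have h0C : h%:C != 0 :> C by rewrite eq_complex /= eqxx andbT gt_eqF.
have fE : (fun y => \sum_k d k * diff_quot h k G y) = (fun y => \sum_k d k * diff_quot h k rem y).
  apply/funext=> y; apply/eqP; rewrite -subr_eq0 -sumrB -[X in _ == X]l0; apply/eqP.
  apply: eq_bigr => k _; rewrite -mulrBr; congr (_ * _).
  by rewrite /diff_quot /rem [y + _ - z]addrAC lD; field.
rewrite /dyadic_mean -/h fE grid_mean_sum.
apply: le_trans (ler_norm_sum _ _ _) _.
apply: le_trans (_ : \sum_k `|d k| * (e / (M + 1))%:C <= _).
  apply: ler_sum => k _; rewrite normrM ler_wpM2l //.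
  have -> : (e / (M + 1))%:C = 2 * (e / c * (2 * (n%:R + 1) * r))%:C / r%:C.
    rewrite -(rmorph_nat (real_complex R)) -rmorphM -fmorph_div /=; congr (_%:C).
    by rewrite /c; field; rewrite gt_eqF // ?gt_eqF ?ltr_wpDl.
  apply: (@grid_mean_diff_bound _ _ _ _ _ _ _ _ N0 h0 Nh); first by rewrite mem_enum.
  move=> y; rewrite size_enum_ord => xy; apply: hdel; first by rewrite !mulr_gt0 // ltr_wpDl.
    by rewrite -ler_pdivlMl ?mulr_gt0 ?ltr_wpDl // mulrC.
  apply: close_le (close_trans (close_sym xz) xy).
  by nra.
rewrite -mulr_suml ME -rmorphM lecR mulrCA -[leRHS]mulr1 ler_wpM2l ?(ltW e0) //.
by rewrite ler_pdivrMr ?mul1r ?lerDl // ltr_wpDl.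
Qed.

End Averages.

(** * Stokes for holomorphic functions on a cube *)

Section Faces.
Variables (R : realType) (n : nat).
Notation C := R[i].
Notation V := 'rV[R]_n.
Notation unitv := (@unitv R n).

Definition zero_at (k : 'I_n) (x : V) : V := \row_j (if j == k then 0 else x 0 j).

Lemma zero_at_same k x a : zero_at k (x + a *: unitv k) = zero_at k x.
Proof. by apply/rowP=> j; rewrite !mxE eqxx /=; case: eqP; rewrite // mulr0 addr0. Qed.

Lemma zero_at_diff k l x a : l != k -> zero_at k (x + a *: unitv l) = zero_at k x + a *: unitv l.
Proof.
move=> lk; apply/rowP=> j; rewrite !mxE eqxx /=; case: (eqVneq j k) => [->|//].
by rewrite eq_sym (negPf lk) mulr0 addr0.
Qed.

Lemma zero_at_id k (x : V) : x 0 k = 0 -> zero_at k x = x.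
Proof. by move=> xk; apply/rowP=> j; rewrite mxE; case: eqP => // ->. Qed.

Lemma zero_at_unit k : zero_at k (unitv k) = 0.
Proof. by apply/rowP=> j; rewrite !mxE eqxx /=; case: eqP. Qed.

Lemma zero_at_unit_neq k l : l != k -> zero_at k (unitv l) = unitv l.
Proof. by move=> lk; apply: zero_at_id; rewrite mxE [k == l]eq_sym (negPf lk) andbF. Qed.

Lemma zero_atC k l x : zero_at k (zero_at l x) = zero_at l (zero_at k x).
Proof. by apply/rowP=> j; rewrite !mxE; case: eqP; case: eqP. Qed.

Lemma zero_atB k x y : zero_at k (x - y) = zero_at k x - zero_at k y.
Proof. by apply/rowP=> j; rewrite !mxE; case: eqP; rewrite // subr0. Qed.

Lemma grid_mean_zero_at N h s k (f : V -> C) x : k \notin s ->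
  grid_mean N h s (f \o zero_at k) x = grid_mean N h s f (zero_at k x).
Proof.
elim: s x => //= l s IH x; rewrite inE negb_or eq_sym => /andP[lk ks].
rewrite /line_mean; congr (_ * _); apply: eq_bigr => i _.
by rewrite IH // zero_at_diff.
Qed.

Definition increment k (f : V -> C) : V -> C := fun x => f (x + unitv k) - f x.

(** Since [N h = 1], telescoping yields the increment over a full unit. The mean in direction [k]
    can stay, because it fixes functions that factor through [zero_at k]. *)
Lemma grid_mean_face N (h : R) s k (f : V -> C) (x : V) : (0 < N)%N -> h != 0 -> N%:R * h = 1 ->
  uniq s -> k \in s -> x 0 k = 0 ->
  grid_mean N h s (diff_quot h k f) x = grid_mean N h s (increment k f \o zero_at k) x.
Proof.
move=> N0 h0 Nh; elim: s x => //= l s IH x /andP[ls us]; rewrite inE => kls xk.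
have [kl|kl] := eqVneq k l.
  rewrite -kl in ls *; rewrite grid_mean_diff line_mean_diff // Nh scale1r divr1.
  have incE : increment k f = fun x => 1 * shift_by (unitv k) f x + (-1) * f x.
    by apply/funext=> y; rewrite /increment /shift_by mul1r mulN1r.
  rewrite /line_mean (eq_bigr (fun=> grid_mean N h s (increment k f) x)); last first.
    by move=> i _; rewrite grid_mean_zero_at // zero_at_same zero_at_id.
  rewrite sumr_const card_ord -[X in _ * X]mulr_natl mulKf ?pnatr_eq0 -?lt0n //.
  by rewrite incE grid_mean_lin grid_mean_shift mul1r mulN1r.
rewrite /line_mean; congr (_ * _); apply: eq_bigr => i _; apply: IH => //.
  by rewrite (negPf kl) in kls.
by rewrite !mxE xk add0r (negPf kl) andbF mulr0.
Qed.

Definition linear_approx (F : V -> C) (z : V) (l : V -> C) :=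
  (forall x h k, l (x + h *: unitv k) = l x + h%:C * l (unitv k)) /\
  forall e : R, 0 < e -> exists2 del : R, 0 < del & forall r y, 0 < r -> r <= del ->
    close r z y -> `|F y - F z - l (y - z)| <= (e * r)%:C.

(* The vector field [d j = c' j * c - c j * c'] is tangent to the face [x_j = 0]
   and annihilates [F j], so its mean flux there vanishes. Telescoping moves the
   sum over [j] of these fluxes to the codimension 2 faces, where the increments
   of the [F j] combine to the constants [E k j]. *)
Lemma stokes (F : 'I_n -> V -> C) (E : 'I_n -> 'I_n -> C) (c c' : 'I_n -> C) :
  (forall j k x, increment k (F j) x - increment j (F k) x = E k j) ->
  (forall j z, exists l, [/\ linear_approx (F j) z l, \sum_k c k * l (unitv k) = 0
     & \sum_k c' k * l (unitv k) = 0]) ->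
  \sum_k \sum_j c k * c' j * E k j = 0.
Proof.
move=> FE Fl; set S := \sum_k _.
pose G j := F j \o zero_at j.
pose d j k := c' j * c k - c j * c' k.
have djj j : d j j = 0 by rewrite /d mulrC subrr.
pose D j := dyadic_mean (fun h x => \sum_k d j k * diff_quot h k (G j) x) 1.
have small j e : 0 < e -> exists p0, forall p, (p0 <= p)%N -> `|D j p 0| <= e%:C.
  apply: goursat => z; have [l [[lD approx] lc lc']] := Fl j (zero_at j z).
  have l0 : l 0 = 0.
    have := lD 0 1 j; rewrite scale1r add0r mul1r => /eqP.
    by rewrite -subr_eq0 opprD addrCA subrr addr0 oppr_eq0 => /eqP.
  exists (l \o zero_at j); split.
  - move=> x h k /=; have [->|kj] := eqVneq k j.
      by rewrite zero_at_same zero_at_unit l0 mulr0 addr0.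
    by rewrite zero_at_diff // lD zero_at_unit_neq.
  - transitivity (c' j * (\sum_k c k * l (unitv k)) - c j * (\sum_k c' k * l (unitv k))).
      rewrite !mulr_sumr -sumrB; apply: eq_bigr => k _; have [->|kj] := eqVneq k j.
        by rewrite djj mul0r !mulrA [c j * _]mulrC subrr.
      by rewrite /= zero_at_unit_neq // /d; ring.
    by rewrite lc lc' !mulr0 subr0.
  move=> e' e'0; have [del del0 hdel] := approx _ e'0; exists del => // r y r0 rd zy.
  rewrite /G /= zero_atB; apply: hdel => // k; rewrite !mxE.
  by case: eqP => _; [rewrite subrr normr0 ltW | apply: zy].
(* The sum is exact at every [p]: [T k j - T j k] is the mean of the constant [E k j], and
   [E j j = 0] settles the diagonal. *)
have DS p : \sum_j D j p 0 = S.
  rewrite /D /dyadic_mean; set h := 1 / 2 ^+ p; set N := (2 ^ p)%N.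
  have N0 : (0 < N)%N by rewrite expn_gt0.
  have h0 : h != 0 by rewrite /h mul1r invr_eq0 expf_neq0 // pnatr_eq0.
  have Nh : N%:R * h = 1 by rewrite /h /N natrX mul1r divff // expf_neq0 // pnatr_eq0.
  pose T k j := grid_mean N h (enum 'I_n) (diff_quot h k (G j)) 0.
  have TE k j : k != j -> T k j - T j k = E k j.
    have TF k' j' : k' != j' -> T k' j' =
        grid_mean N h (enum 'I_n) (increment k' (F j') \o (zero_at k' \o zero_at j')) 0.
      move=> kj; rewrite /T grid_mean_face ?enum_uniq ?mem_enum ?mxE //.
      congr (grid_mean _ _ _ _ _); apply/funext=> y /=; rewrite /increment /G /=.
      by rewrite -(scale1r (unitv k')) zero_at_diff // zero_atC.
    move=> kj; rewrite !TF // 1?eq_sym //.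
    rewrite -[LHS]/(_ + - _) -[X in X - _]mul1r -mulN1r.
    pose u := increment k (F j) \o (zero_at k \o zero_at j).
    pose w := increment j (F k) \o (zero_at j \o zero_at k).
    rewrite -[LHS]/((fun x => 1 * grid_mean N h (enum 'I_n) u x +
       (-1) * grid_mean N h (enum 'I_n) w x) 0) -grid_mean_lin.
    have -> : (fun x => 1 * u x + -1 * w x) = fun=> E k j.
      by apply/funext=> y; rewrite /u /w /= mul1r mulN1r zero_atC FE.
    by rewrite grid_mean_cst.
  under eq_bigr do rewrite grid_mean_sum.
  rewrite -/T /d.
  have -> : \sum_j \sum_k (c' j * c k - c j * c' k) * T k j =
     \sum_k \sum_j c k * c' j * T k j - \sum_k \sum_j c k * c' j * T j k.
    rewrite [X in X - _]exchange_big /= -sumrB; apply: eq_bigr => j _.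
    by rewrite -sumrB; apply: eq_bigr => k _; ring.
  rewrite -sumrB; apply: eq_bigr => k _; rewrite -sumrB; apply: eq_bigr => j _.
  rewrite -mulrBr; have [->|kj] := eqVneq k j; last by rewrite TE.
  by rewrite -(FE j j 0) !subrr.
apply/eqP/contraT => S0.
have [r rE] : exists r : R, `|S| = r%:C by exists (complex.Re `|S|); rewrite RRe_real // normr_real.
have r0 : 0 < r by rewrite -ltcR -rE normr_gt0.
(* [n] fluxes of size at most [e] sum to less than [r = |S|]. *)
pose e := r / (2 * (n%:R + 1)).
have n1 : 0 < n%:R + 1 :> R by rewrite ltr_wpDl // ler0n.
have e0 : 0 < e by rewrite divr_gt0 // mulr_gt0.
have /choice[p0 hp0] j := small j e e0.
pose p := (\sum_j p0 j)%N.
have : `|S| <= (n%:R * e)%:C.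
  rewrite -(DS p); apply: le_trans (ler_norm_sum _ _ _) _.
  rewrite mulr_natl rmorphMn /= -[X in _ *+ X]card_ord -sumr_const.
  by apply: ler_sum => j _; apply: hp0; rewrite /p (bigD1 j) //= leq_addr.
rewrite rE lecR leNgt => /negP[]; rewrite /e mulrCA -[ltRHS]mulr1 ltr_pM2l //.
rewrite ltr_pdivrMr ?mulr_gt0 // mul1r; have : 0 <= n%:R :> R by []; lra.
Qed.

End Faces.

(** * Chern classes are invariant forms *)

Section ChernClass.
Variables (R : realType) (g : nat) (A : complexTorus R g).
Notation C := R[i].
Notation cmx A := (map_mx (real_complex R) A).
Notation ev := (@unitv R g.*2).

Lemma real_pointZ a s : real_point A (a *: s) = a%:C *: real_point A s.
Proof. by rewrite /real_point (map_mxZ (real_complex R)) scalemxAl. Qed.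

Lemma real_point_unitv k : real_point A (ev k) = row k (periods A).
Proof. by rewrite /real_point /unitv (map_delta_mx (real_complex R)) -rowE. Qed.

Lemma real_point_sum s : real_point A s = \sum_k (s 0 k)%:C *: real_point A (ev k).
Proof.
rewrite {1}/real_point mulmx_sum_row; apply: eq_bigr => k _.
by rewrite mxE real_point_unitv.
Qed.

Lemma real_point_bound : exists2 c : R, 0 < c & forall (r : R) (s : 'rV[R]_(g.*2)), 0 <= r -> (forall j, `|s 0 j| <= r) ->
  `|real_point A s| <= (c * r)%:C.
Proof.
pose M := \sum_k `|real_point A (ev k)|.
have M0 : 0 <= M by apply: sumr_ge0.
have ME : M = (complex.Re M)%:C by rewrite RRe_real // ger0_real.
exists (complex.Re M + 1) => [|r s r0 sr].
  by rewrite ltr_wpDl // -ler0c -ME.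
rewrite real_point_sum (le_trans (ler_norm_sum _ _ _)) //.
apply: le_trans (_ : (complex.Re M * r)%:C <= _); last by rewrite lecR ler_wpM2r ?lerDl.
rewrite rmorphM /= -ME /M mulr_suml; apply: ler_sum => k _.
by rewrite normrZ mulrC ler_wpM2l // normc_real lecR.
Qed.

(** The derivative is complex linear on [V], so complex relations among the periods pass to its
    values on the lattice basis: the Cauchy-Riemann equations in lattice coordinates. *)
Lemma holomorphic_linear_approx (f : 'rV[C]_g -> C^o) z : holomorphic f ->
  exists l : 'rV[R]_(g.*2) -> C, linear_approx (f \o real_point A) z l /\
    forall c : 'rV[C]_(g.*2), c *m periods A = 0 -> \sum_k c 0 k * l (ev k) = 0.
Proof.
move=> fhol; have [df hdf] := differentiable_linear_approx (fhol (real_point A z)).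
exists (df \o real_point A); split; last first.
  move=> c cP; transitivity (df (c *m periods A)); last by rewrite cP linear0.
  rewrite mulmx_sum_row linear_sum; apply: eq_bigr => k _.
  by rewrite linearZ /= real_point_unitv.
split=> [x h k|e e0]; first by rewrite /= real_pointD real_pointZ linearD linearZ.
have [c c0 hc] := real_point_bound.
have ec0 : 0 < (e / c)%:C by rewrite ltcR divr_gt0.
have [d d0 hd] := hdf _ ec0.
have dE : d = (complex.Re d)%:C by rewrite RRe_real // gtr0_real.
move: (complex.Re d) dE => d' dE; rewrite {}dE ltcR in d0 hd.
exists (d' / (2 * c)); first by rewrite divr_gt0 ?mulr_gt0.
move=> r y r0 rd zy; have hb : `|real_point A (y - z)| <= (c * r)%:C.
  by apply: hc => [|j]; [apply: ltW | rewrite !mxE; apply: zy].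
have := hd (real_point A (y - z)); rewrite -real_pointD subrKC opprD addrA => h.
apply: le_trans (h _) _.
  apply: le_lt_trans hb _; rewrite ltcR; move: rd; rewrite ler_pdivlMr ?mulr_gt0 //.
  have := mulr_gt0 r0 c0; lra.
apply: le_trans (ler_wpM2l (ltW ec0) hb) _.
by rewrite -rmorphM mulrA divfK // gt_eqF.
Qed.

Lemma cmx_real_part m n (X Y : 'M[R]_(m, n)) : cmx X + 'i%C *: cmx Y = 0 -> X = 0.
Proof.
move=> /matrixP h; apply/matrixP=> p q; have := h p q; rewrite !mxE; simpc.
by case.
Qed.

Variable J : 'M[R]_(g.*2).
Hypothesis JA : forall s, real_point A (s *m J) = 'i%C *: real_point A s.

(** The rows of [W = 1 + i J] are relations among the periods, so [stokes] gives [W E W^T = 0], the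
    vanishing of the (0,2)-part of [E]. Its real part is [E - J E J^T]. *)
Lemma neron_severi_nsform E : neron_severi A E -> nsform J (map_mx intr E).
Proof.
move=> [e [_ [f [fhol _ fE]]]].
pose ej j : 'rV[int]_(g.*2) := delta_mx 0 j.
have lat j : lattice_point A (ej j) = real_point A (ev j).
  by rewrite real_point_unitv /lattice_point /ej map_delta_mx -rowE.
have altE k j : alt_form E (ej k) (ej j) = E k j.
  by rewrite /alt_form /ej trmx_delta -rowE -colE !mxE.
have Eanti j k : E j k = - E k j.
  apply: (@intr_inj C); rewrite rmorphN /= -!altE (fE (ej j) _ 0) (fE (ej k) _ 0).
  by move: (f (ej j) (0 + _)) (f (ej j) 0) (f (ej k) (0 + _)) (f (ej k) 0) => p q r s; ring.
pose F j := (f (ej j) : _ -> C) \o real_point A.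
pose W : 'M[C]_(g.*2) := 1%:M + 'i%C *: cmx J.
have WP p : row p W *m periods A = 0.
  have -> : row p W = cmx (ev p) + 'i%C *: cmx (ev p *m J).
    rewrite -rowE; apply/rowP=> j; rewrite !mxE eqxx /= [j == p]eq_sym.
    by case: (p == j).
  rewrite mulmxDl -scalemxAl -![cmx _ *m _]/(real_point A _) JA scalerA -expr2 sqr_i.
  by rewrite scaleN1r subrr.
have st p q : \sum_k \sum_j W p k * W q j * (E k j)%:~R = 0.
  apply: (@stokes _ _ F (fun k j => (E k j)%:~R) (W p) (W q)).
    move=> j k x; rewrite -altE (fE _ _ (real_point A x)) /increment /F /= !real_pointD !lat.
    move: (f (ej j) (_ + _)) (f (ej j) (real_point A x)).
    move: (f (ej k) (_ + _)) (f (ej k) (real_point A x)) => a b c d.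
    by ring.
  move=> j z; have [l [la lc]] := holomorphic_linear_approx z (fhol (ej j)).
  exists l; split=> //.
    by rewrite -[RHS](lc _ (WP p)); apply: eq_bigr => k _; rewrite [in RHS]mxE.
  by rewrite -[RHS](lc _ (WP q)); apply: eq_bigr => k _; rewrite [in RHS]mxE.
have WE : W *m cmx (map_mx intr E) *m W^T = 0.
  apply/matrixP=> p q; rewrite [RHS]mxE -[RHS](st p q) exchange_big mxE /=.
  apply: eq_bigr => j _; rewrite mxE mulr_suml; apply: eq_bigr => k _.
  by rewrite !mxE rmorph_int; ring.
have WE2 : W *m cmx (map_mx intr E) *m W^T =
    cmx (map_mx intr E - J *m map_mx intr E *m J^T) +
    'i%C *: cmx (J *m map_mx intr E + map_mx intr E *m J^T).
  rewrite /W linearD /= trmx1 linearZ /= map_trmx mulmxDl mul1mx mulmxDr mulmx1 mulmxDl.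
  rewrite -!scalemxAl -!scalemxAr scalerA -expr2 sqr_i scaleN1r -!map_mxM.
  rewrite map_mxB map_mxD; move: (cmx _) (cmx _) (cmx _) (cmx _) => a b c d.
  by rewrite scalerDr; apply/matrixP=> p q; rewrite !mxE; ring.
have key : J *m map_mx intr E *m J^T = map_mx intr E.
  apply/eqP; rewrite eq_sym -subr_eq0; apply/eqP.
  exact: cmx_real_part (etrans (esym WE2) WE).
split; last by rewrite map_intr_ratr.
by apply/matrixP=> j k; rewrite !mxE Eanti rmorphN.
Qed.

End ChernClass.

(** * Picard sets and disjointness of the strata *)

Section PicardNumbers.
Variable R : realType.

Lemma neron_severi_rank g (A : complexTorus R g) J :
  (forall s, real_point A (s *m J) = 'i%C *: real_point A s) -> cplx J ->
  has_rank (neron_severi A) (rho J).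
Proof.
move=> JA JJ; apply: integral_forms_rank => E; first exact: neron_severi_nsform.
exact: nsform_neron_severi.
Qed.

Lemma abelian_variety_polarized g (A : complexTorus R g) J :
  (forall s, real_point A (s *m J) = 'i%C *: real_point A s) -> cplx J ->
  abelian_variety A <-> polarized J.
Proof.
move=> JA JJ; split.
  move=> [E [/(neron_severi_nsform JA) nE pE]]; exists (map_mx intr E); split=> //.
  exact/(positive_definite_posform JA).
move=> [E [nE pE]]; have [N [E' [N0 hN]]] := clear_matrix_denominators E.
have nE' : nsform J (map_mx intr E').
  by rewrite -hN -[_ *: _]addr0; apply: nsformD nE (nsform0 J).
exists (E' *+ 2); split; first exact: nsform_neron_severi.
apply/(positive_definite_posform JA) => s s0.
have -> : map_mx intr (E' *+ 2) = (2 * N%:~R) *: E.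
  by rewrite raddfMn /= -hN -scalerA scaler_nat.
rewrite map_mxZ -scalemxAr -scalemxAl mxE mulr_gt0 //; last exact: pE.
by rewrite ltr0q mulr_gt0 // ltr0z.
Qed.

Lemma picard_setE g : picard_set R g = [set r | abelian_rho R g r].
Proof.
rewrite /picard_set; case: eqVneq => [->|_].
  by apply/seteqP; split=> r; rewrite /= abelian_rho0.
apply/seteqP; split=> r /=.
  move=> [A [Aab Ar]]; have [J [JJ JA]] := torus_complex_structure A.
  exists g.*2, J; split=> //; first exact/(abelian_variety_polarized JA JJ).
  exact: has_rank_unique (neron_severi_rank JA JJ) Ar.
move=> [m [J [mg JJ pJ <-]]]; subst m.
have [A JA] := complex_structure_torus JJ; exists A; split.
  exact/(abelian_variety_polarized JA JJ).
exact: neron_severi_rank.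
Qed.

Lemma picard_stratumP g n r : picard_stratum R g n r <->
  exists2 x, abelian_rho R n x & r = ((g - n) ^ 2 + x)%N.
Proof.
rewrite /picard_stratum picard_setE /=.
by split=> -[x xn e]; exists x.
Qed.

(** The squares of [g - n] and [g - n'] differ by at least [2 (g - n) - 1 >= g - n], more than the
    Picard number of any abelian variety of dimension [n']. *)
Lemma picard_stratum_lt g n n' r : (n < n' <= g)%N -> (n' ^ 2 < g - n)%N ->
  picard_stratum R g n r -> ~ picard_stratum R g n' r.
Proof.
move=> /andP[nn' ng] gn /picard_stratumP[x _ ->] /picard_stratumP[y /abelian_rho_le yn].
have : ((g - n' + 1) ^ 2 <= (g - n) ^ 2)%N by rewrite leq_sqr; lia.
rewrite sqrnD; nia.
Qed.

End PicardNumbers.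

Local Close Scope complex_scope.
Local Close Scope ring_scope.
Unset Implicit Arguments.

Theorem theorem7p4 (R : realType) (l : nat) (hl : (0 < l)%N) :
  exists gl : nat, (l <= gl)%N /\
    forall g : nat, (gl <= g)%N ->
      [set rho | ((g - l) ^ 2 + 1 <= rho <= g ^ 2)%N] `&` picard_set R g
        = \bigcup_(n in [set n | (n <= l)%N]) picard_stratum R g n
      /\ trivIset [set n | (n <= l)%N] (picard_stratum R g).
Proof.
exists (l + (4 * l + 2) ^ 2)%N; split=> [|g lg]; first exact: leq_addr.
have l_lt : (l ^ 2 < g - l)%N by nia.
have lg' : (l <= g)%N by apply: leq_trans (leq_addr _ _) lg.
split.
  apply/seteqP; split=> [r [/andP[lr _]]|r [n /= nl /picard_stratumP[x nx ->]]].
    rewrite picard_setE => /(abelian_rho_large lg)/(_ lr) [n [x [nl nx ->]]].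
    by exists n => //; apply/picard_stratumP; exists x.
  have ng : (n <= g)%N by apply: leq_trans lg'.
  have ag := abelian_rho_add ng nx.
  split; last by rewrite picard_setE.
  rewrite /= (abelian_rho_le ag) andbT.
  have [nl'|ln] := ltnP n l.
    have : ((g - l + 1) ^ 2 <= (g - n) ^ 2)%N by rewrite leq_sqr; lia.
    by rewrite sqrnD; lia.
  (* Only [n = l] touches the lower end of the range; there [l > 0] makes the Picard number [x]
     positive. *)
  have nE : n = l by apply/eqP; rewrite eqn_leq nl.
  rewrite nE leq_add2l; apply: (@abelian_rho_gt0 R l) => //.
  by rewrite -nE.
apply/trivIsetP => n n' /= nl nl' nn'; apply/seteqP; split=> // r [h h'] /=.
have [lt|lt|eq] := ltngtP n n'; last by rewrite eq eqxx in nn'.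
  apply: picard_stratum_lt h h'; [by rewrite lt (leq_trans nl') | nia].
apply: picard_stratum_lt h' h; [by rewrite lt (leq_trans nl) | nia].
Qed.
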